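(* For any zero-dimensional (not necessarily reduced) closed subscheme $X$ of $\mathbb{P}^1\times\mathbb{P}^1$, there is a bihomogeneous ideal $J\subset S$ such that $\sqrt{J}=\sqrt{I_X}$ and $S/J$ has a virtual resolution that is a length two Koszul complex, i.e. the Koszul complex $K(f,g)$ of two bihomogeneous forms $f,g\in S$.
   Context: Let $\Bbbk$ be an algebraically closed field; $\mathbb{P}^1\times\mathbb{P}^1$ is over $\Bbbk$. The Cox ring is $S=\Bbbk[x_0,x_1,y_0,y_1]$, $\mathbb{Z}^2$-graded with $\deg x_i=(1,0)$ and $\deg y_i=(0,1)$, and $B=\langle x_0,x_1\rangle\cap\langle y_0,y_1\rangle$ is the irrelevant ideal. Closed subschemes of $\mathbb{P}^1\times\mathbb{P}^1$ are in one-to-one correspondence with $B$-saturated bihomogeneous ideals of $S$; $I_X$ denotes the $B$-saturated ideal corresponding to $X$. A virtual resolution of $S/I$ ($I$ a bihomogeneous ideal) is a $\mathbb{Z}^2$-graded complex of free $S$-modules $F_\bullet=[F_0\xleftarrow{\varphi_1}F_1\xleftarrow{\varphi_2}F_2\leftarrow\cdots]$ such that for every $i\ge 1$ the annihilator of $H_i(F_\bullet)$ contains $B^\ell$ for some $\ell>0$, and the sheaves on $\mathbb{P}^1\times\mathbb{P}^1$ associated to $S/I$ and $\operatorname{coker}(\varphi_1)$ are isomorphic. *)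

(* Defs.v *)
From HB Require Import structures.
From mathcomp Require Import all_boot all_order all_algebra.
From mathcomp Require Export mpoly.

Set Implicit Arguments.
Unset Strict Implicit.
Unset Printing Implicit Defensive.

Import GRing.Theory.
Local Open Scope ring_scope.

(** The Cox ring of P^1 x P^1: the variables 0, 1, 2, 3 are x_0, x_1, y_0, y_1. *)
Notation cox k := {mpoly k[4]}.

Definition x0 {k : fieldType} : cox k := 'X_(@Ordinal 4 0 isT).
Definition x1 {k : fieldType} : cox k := 'X_(@Ordinal 4 1 isT).
Definition y0 {k : fieldType} : cox k := 'X_(@Ordinal 4 2 isT).
Definition y1 {k : fieldType} : cox k := 'X_(@Ordinal 4 3 isT).

Definition mbideg (m : 'X_{1..4}) : int * int :=
  (Posz (m (@Ordinal 4 0 isT) + m (@Ordinal 4 1 isT)),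
   Posz (m (@Ordinal 4 2 isT) + m (@Ordinal 4 3 isT))).

(** As usual, 0 is a form of every bidegree. *)
Definition bihomog {k : fieldType} (d : int * int) (p : cox k) : Prop :=
  forall m : 'X_{1..4}, m \in msupp p -> mbideg m = d.

Definition bicomp {k : fieldType} (d : int * int) (p : cox k) : cox k :=
  \sum_(m <- msupp p | mbideg m == d) p@_m *: 'X_[m].

(** Ideals are Prop-valued and may be improper (MathComp's [idealr] is boolean
    and proper). *)
Definition is_ideal {k : fieldType} (I : cox k -> Prop) : Prop :=
  [/\ I 0,
      forall p q, I p -> I q -> I (p + q) &
      forall a p, I p -> I (a * p)].

Definition bihomog_ideal {k : fieldType} (I : cox k -> Prop) : Prop :=
  is_ideal I /\ forall d p, I p -> I (bicomp d p).

Definition radical {k : fieldType} (I : cox k -> Prop) (p : cox k) : Prop :=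
  exists n : nat, I (p ^+ n).

Definition ideal2 {k : fieldType} (a b : cox k) (p : cox k) : Prop :=
  exists u v : cox k, p = u * a + v * b.

Definition ideal_mul {k : fieldType} (I J : cox k -> Prop) (p : cox k) : Prop :=
  exists s : seq (cox k * cox k),
    (forall ab, ab \in s -> I ab.1 /\ J ab.2) /\ p = \sum_(ab <- s) ab.1 * ab.2.

Fixpoint ideal_exp {k : fieldType} (I : cox k -> Prop) (n : nat) : cox k -> Prop :=
  if n is n'.+1 then ideal_mul I (ideal_exp I n') else fun _ => True.

Definition irrelevant {k : fieldType} (p : cox k) : Prop :=
  ideal2 x0 x1 p /\ ideal2 y0 y1 p.

(** I : B^oo = I *)
Definition B_saturated {k : fieldType} (I : cox k -> Prop) : Prop :=
  forall (l : nat) (p : cox k),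
    (forall b, ideal_exp irrelevant l b -> I (b * p)) -> I p.

(** A closed subscheme of P^1 x P^1, given by its B-saturated bihomogeneous
    ideal. *)
Record closed_subscheme (k : fieldType) := ClosedSubscheme {
  scheme_ideal : cox k -> Prop;
  scheme_bihomog : bihomog_ideal scheme_ideal;
  scheme_saturated : B_saturated scheme_ideal
}.

(** The (scheme-theoretic) points of P^1 x P^1, equivalently its irreducible
    closed subsets, are the bihomogeneous primes not containing B; those of X
    are the ones containing I_X. *)
Definition is_point {k : fieldType} (P : cox k -> Prop) : Prop :=
  [/\ bihomog_ideal P,
      ~ P 1,
      forall a b, P (a * b) -> P a \/ P b &
      ~ (forall b, irrelevant b -> P b)].

Definition point_of {k : fieldType} (X : closed_subscheme k)
    (P : cox k -> Prop) : Prop :=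
  is_point P /\ forall p, scheme_ideal X p -> P p.

(** Strict chains P_0 < ... < P_n of points under specialization, i.e. strict
    chains of irreducible closed subsets of X of length n. *)
Definition point_chain {k : fieldType} (X : closed_subscheme k) (n : nat)
    (P : nat -> cox k -> Prop) : Prop :=
  (forall i, (i <= n)%N -> point_of X (P i)) /\
  (forall i, (i < n)%N ->
     (forall p, P i p -> P i.+1 p) /\ exists p, P i.+1 p /\ ~ P i p).

(** Krull dimension; the empty scheme has no dimension in nat. *)
Definition has_dim {k : fieldType} (X : closed_subscheme k) (n : nat) : Prop :=
  (exists P, point_chain X n P) /\ ~ (exists P, point_chain X n.+1 P).

(** The graded module (⊕_j S(- twist j)) / rel. It is handled through the free
    module and congruence modulo rel rather than as a quotient type. *)
Record gmodule (k : fieldType) := GModule {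
  gen : nat;
  twist : 'I_gen -> int * int;
  rel : 'cV[cox k]_gen -> Prop
}.

Definition vhomog {k : fieldType} {r : nat} (a : 'I_r -> int * int)
    (d : int * int) (v : 'cV[cox k]_r) : Prop :=
  forall j, bihomog (d - a j) (v j 0).

Definition quot_module {k : fieldType} (I : cox k -> Prop) : gmodule k :=
  @GModule k 1 (fun _ => 0) (fun v => I (v 0 0)).

(** The sheaf associated with M on the basis of opens D(h), h <> 0 a form of
    bidegree dh with both entries positive: its sections on D(h) form the
    bidegree 0 part of M_h. The pair (v, n) stands for the fraction v / h^n. *)
Definition fraction {k : fieldType} (M : gmodule k) : Type :=
  ('cV[cox k]_(gen M) * nat)%type.

Definition is_section {k : fieldType} (M : gmodule k) (dh : int * int)
    (s : fraction M) : Prop :=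
  vhomog (@twist k M) (dh *+ s.2) s.1.

Definition section_eq {k : fieldType} (M : gmodule k) (h : cox k)
    (s t : fraction M) : Prop :=
  exists l : nat, rel (h ^+ l *: (h ^+ t.2 *: s.1 - h ^+ s.2 *: t.1)).

Definition section_add {k : fieldType} (M : gmodule k) (h : cox k)
    (s t : fraction M) : fraction M :=
  (h ^+ t.2 *: s.1 + h ^+ s.2 *: t.1, (s.2 + t.2)%N).

(** Multiplication by the regular function c.1 / h^c.2 on D(h). *)
Definition section_scale {k : fieldType} (M : gmodule k)
    (c : cox k * nat) (s : fraction M) : fraction M :=
  (c.1 *: s.1, (c.2 + s.2)%N).

(** Restriction from D(h) to D(h * h'): v / h^n = (h'^n v) / (h h')^n. *)
Definition section_res {k : fieldType} (M : gmodule k) (h' : cox k)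
    (s : fraction M) : fraction M :=
  (h' ^+ s.2 *: s.1, s.2).

Definition basic_open {k : fieldType} (dh : int * int) (h : cox k) : Prop :=
  [/\ h != 0, bihomog dh h, (0 < dh.1)%R & (0 < dh.2)%R].

(** An isomorphism of sheaves of modules M~ -> N~: a family of bijective
    O(D(h))-linear maps [phi h], given on representatives, which commutes with
    restrictions. *)
Definition sheaf_iso {k : fieldType} (M N : gmodule k)
    (phi : cox k -> fraction M -> fraction N) : Prop :=
  (forall dh h, basic_open dh h ->
    [/\ forall s, is_section dh s -> is_section dh (phi h s),
        forall s t, is_section dh s -> is_section dh t ->
          (section_eq h s t <-> section_eq h (phi h s) (phi h t)),
        forall u, is_section dh u ->
          exists2 s, is_section dh s & section_eq h (phi h s) u,
        forall s t, is_section dh s -> is_section dh t ->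
          section_eq h (phi h (section_add h s t))
                       (section_add h (phi h s) (phi h t)) &
        forall c s, bihomog (dh *+ c.2) c.1 -> is_section dh s ->
          section_eq h (phi h (section_scale c s))
                       (section_scale c (phi h s))]) /\
  (forall dh h d' h', basic_open dh h -> h' != 0 -> bihomog d' h' ->
     basic_open (dh + d') (h * h') ->
     forall s, is_section dh s ->
       section_eq (h * h') (phi (h * h') (section_res h' s))
                           (section_res h' (phi h s))).

Definition sheaves_isomorphic {k : fieldType} (M N : gmodule k) : Prop :=
  exists phi, @sheaf_iso k M N phi.

(** F_i = ⊕_j S(- tw i j), and dif i : F_(i+1) -> F_i acts on columns; so
    dif i is phi_(i+1). *)
Record free_seq (k : fieldType) := FreeSeq {
  rk : nat -> nat;
  tw : forall i, 'I_(rk i) -> int * int;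
  dif : forall i, 'M[cox k]_(rk i, rk i.+1)
}.

Definition graded_complex {k : fieldType} (F : free_seq k) : Prop :=
  (forall i p q, bihomog (tw q - tw p) (dif F i p q)) /\
  (forall i, dif F i *m dif F i.+1 = 0).

(** The coefficient b annihilates H_(i+1)(F). *)
Definition annihilates_homology {k : fieldType} (F : free_seq k) (i : nat)
    (b : cox k) : Prop :=
  forall v : 'cV[cox k]_(rk F i.+1), dif F i *m v = 0 ->
    exists w : 'cV[cox k]_(rk F i.+2), b *: v = dif F i.+1 *m w.

Definition coker_module {k : fieldType} (F : free_seq k) : gmodule k :=
  @GModule k (rk F 0) (@tw k F 0)
    (fun v => exists w : 'cV[cox k]_(rk F 1), v = dif F 0 *m w).

Definition virtual_resolution {k : fieldType} (I : cox k -> Prop)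
    (F : free_seq k) : Prop :=
  [/\ graded_complex F,
      forall i, exists2 l, (0 < l)%N &
        forall b, ideal_exp irrelevant l b -> annihilates_homology F i b &
      sheaves_isomorphic (quot_module I) (coker_module F)].

(** The Koszul complex
      S <-[f g]- S(-d) ⊕ S(-e) <-[-g f]^T- S(-d-e) <- 0
    of forms f, g of bidegrees d, e. *)
Definition koszul_rk (i : nat) : nat :=
  match i with 0 => 1 | 1 => 2 | 2 => 1 | _ => 0 end.

Definition koszul_tw (d e : int * int) (i : nat) : 'I_(koszul_rk i) -> int * int :=
  match i return 'I_(koszul_rk i) -> int * int with
  | 0 => fun _ => 0
  | 1 => fun j => if j == 0 then d else e
  | 2 => fun _ => d + e
  | _ => fun _ => 0
  end.

Definition koszul_dif {k : fieldType} (f g : cox k) (i : nat) :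
    'M[cox k]_(koszul_rk i, koszul_rk i.+1) :=
  match i return 'M[cox k]_(koszul_rk i, koszul_rk i.+1) with
  | 0 => \row_(j < 2) (if j == 0 then f else g)
  | 1 => \col_(j < 2) (if j == 0 then - g else f)
  | _ => 0
  end.

Definition koszul {k : fieldType} (d e : int * int) (f g : cox k) : free_seq k :=
  @FreeSeq k koszul_rk (@koszul_tw d e) (koszul_dif f g).

(* Main.v *)
Require Import Defs.
From HB Require Import structures.
From mathcomp Require Import all_boot all_order all_algebra.
From mathcomp Require Import ring.
From Stdlib Require Import Classical.

(** A finite set V of points is cut out by f, the product of the linear forms in
    x of the columns meeting V, together with g, the sum over these columns c of
    G_c(y) times the linear forms of the other columns, where the G_c have a
    common degree and G_c vanishes exactly on the fibre of V over c. The pair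
    f, g is a regular sequence, so its Koszul complex is even acyclic, and J is
    the saturation of (f, g).

    It remains to see that X has finitely many points and that they determine
    the radical of I_X. In an affine chart k[s][t], if I_X had no element
    depending on s alone, pseudo-division by an element of least t-degree would
    put X on a curve {q = 0} with q irreducible of positive t-degree, and
    specializing s would give a chain (q) < (s - a, t - b) of points of X. Hence
    I_X contains a product of linear forms in x and one in y; a saturated ideal
    containing two such products has for radical the intersection of the ideals
    of the grid points lying on it, as one sees modulo each pair of linear
    forms. *)

Set Implicit Arguments.
Unset Strict Implicit.
Unset Printing Implicit Defensive.

Import GRing.Theory.
Local Open Scope ring_scope.

(** * Variables and bidegrees of the Cox ring *)

(** The first Boolean is the side (false for x, true for y), the second the subscript, so that
    statements about the two factors are proved once for a variable side. *)
Definition var_idx (a b : bool) : 'I_4 :=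
  match a, b with
  | false, false => @Ordinal 4 0 isT
  | false, true => @Ordinal 4 1 isT
  | true, false => @Ordinal 4 2 isT
  | true, true => @Ordinal 4 3 isT
  end.

Definition var (k : fieldType) (a b : bool) : cox k := 'X_(var_idx a b).

Definition asg (T : Type) (v : bool -> bool -> T) (i : 'I_4) : T :=
  v (1 < i)%N (odd i).

Lemma asg_var_idx T (v : bool -> bool -> T) a b : asg v (var_idx a b) = v a b.
Proof. by case: a; case: b. Qed.

Lemma var_idxP (i : 'I_4) : exists a b, i = var_idx a b.
Proof.
by exists (1 < i)%N, (odd i); apply: val_inj; case: i => -[|[|[|[|]]]].
Qed.

Definition sdeg (a : bool) (m : 'X_{1..4}) : nat :=
  m (var_idx a false) + m (var_idx a true).

Lemma mbidegE m : mbideg m = (Posz (sdeg false m), Posz (sdeg true m)).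
Proof. by []. Qed.

Lemma sdegD a m n : sdeg a (m + n)%MM = (sdeg a m + sdeg a n)%N.
Proof. by rewrite /sdeg !mnmDE addnACA. Qed.

Lemma mbidegD m n : mbideg (m + n)%MM = mbideg m + mbideg n.
Proof. by rewrite !mbidegE !sdegD. Qed.

Lemma prod_var_idx (R : comPzSemiRingType) (F : 'I_4 -> R) :
  \prod_i F i = F (var_idx false false) * F (var_idx false true) *
                (F (var_idx true false) * F (var_idx true true)).
Proof.
rewrite !big_ord_recl big_ord0 mulr1 !mulrA.
by congr (_ * _ * _ * _); congr F; apply: val_inj.
Qed.

Lemma mmap1_asg (R : comNzRingType) (v : bool -> bool -> R) (m : 'X_{1..4}) :
  mmap1 (asg v) m =
    v false false ^+ m (var_idx false false) * v false true ^+ m (var_idx false true) *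
    (v true false ^+ m (var_idx true false) * v true true ^+ m (var_idx true true)).
Proof. by rewrite /mmap1 prod_var_idx !asg_var_idx. Qed.

(** * Ideals, colon ideals and congruences *)

Section Ideals.

Variable k : fieldType.
Implicit Types (p q : cox k) (I : cox k -> Prop).

Lemma ideal0 I : is_ideal I -> I 0. Proof. by case. Qed.

Lemma idealD I p q : is_ideal I -> I p -> I q -> I (p + q).
Proof. by case=> _ hD _; apply: hD. Qed.

Lemma idealMl I a p : is_ideal I -> I p -> I (a * p).
Proof. by case=> _ _; apply. Qed.

Lemma idealMr I a p : is_ideal I -> I p -> I (p * a).
Proof. by move=> hI hp; rewrite mulrC; apply: idealMl. Qed.

Lemma idealN I p : is_ideal I -> I p -> I (- p).
Proof. by move=> hI hp; rewrite -mulN1r; apply: idealMl. Qed.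

Lemma idealB I p q : is_ideal I -> I p -> I q -> I (p - q).
Proof. by move=> hI hp hq; apply: idealD => //; apply: idealN. Qed.

Lemma idealZ I c p : is_ideal I -> I p -> I (c *: p).
Proof. by move=> hI hp; rewrite -mul_mpolyC; apply: idealMl. Qed.

Lemma idealX_le I p m n : is_ideal I -> (m <= n)%N -> I (p ^+ m) -> I (p ^+ n).
Proof. by move=> hI /subnK <- hp; rewrite exprD; apply: idealMl. Qed.

Lemma ideal_sum I (T : eqType) (s : seq T) (F : T -> cox k) :
  is_ideal I -> (forall t, t \in s -> I (F t)) -> I (\sum_(t <- s) F t).
Proof.
move=> hI; elim: s => [|t s IH] hF; first by rewrite big_nil; apply: ideal0.
rewrite big_cons; apply: idealD => //; first by apply: hF; rewrite mem_head.
by apply: IH => u us; apply: hF; rewrite inE us orbT.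
Qed.

Lemma ideal_transl I p q : is_ideal I -> I (p - q) -> I q -> I p.
Proof. by move=> hI h1 h2; rewrite -(subrK q p); apply: idealD. Qed.

Lemma ideal_transr I p q : is_ideal I -> I (p - q) -> I p -> I q.
Proof.
move=> hI h1 h2; have -> : q = p - (p - q) by ring.
by apply: idealB.
Qed.

Lemma ideal_congrM I p1 q1 p2 q2 : is_ideal I ->
  I (p1 - q1) -> I (p2 - q2) -> I (p1 * p2 - q1 * q2).
Proof.
move=> hI h1 h2.
have -> : p1 * p2 - q1 * q2 = p2 * (p1 - q1) + q1 * (p2 - q2) by ring.
by apply: idealD => //; apply: idealMl.
Qed.

Lemma ideal_congrX I p q n : is_ideal I -> I (p - q) -> I (p ^+ n - q ^+ n).
Proof.
move=> hI h; elim: n => [|n IH]; first by rewrite subrr; apply: ideal0.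
by rewrite !exprS; apply: ideal_congrM.
Qed.

Lemma ideal2_ideal (a b : cox k) : is_ideal (ideal2 a b).
Proof.
split.
- by exists 0, 0; ring.
- by move=> p q [u [v ->]] [u' [v' ->]]; exists (u + u'), (v + v'); ring.
- by move=> c p [u [v ->]]; exists (c * u), (c * v); ring.
Qed.

Lemma ideal2l (a b : cox k) : ideal2 a b a. Proof. by exists 1, 0; ring. Qed.
Lemma ideal2r (a b : cox k) : ideal2 a b b. Proof. by exists 0, 1; ring. Qed.

Lemma ideal2_sub I (a b p : cox k) :
  is_ideal I -> I a -> I b -> ideal2 a b p -> I p.
Proof. by move=> hI ha hb [u [v ->]]; apply: idealD => //; apply: idealMl. Qed.

(** The ideal I + (a), used to work on the locus a = 0. *)
Definition ideal_adjoin I (a p : cox k) : Prop := exists u, I (p - u * a).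

Lemma ideal_adjoin_ideal I a : is_ideal I -> is_ideal (ideal_adjoin I a).
Proof.
move=> hI; split.
- by exists 0; rewrite mul0r subrr; apply: ideal0.
- move=> p q [u hu] [v hv]; exists (u + v).
  have -> : p + q - (u + v) * a = (p - u * a) + (q - v * a) by ring.
  by apply: idealD.
- move=> c p [u hu]; exists (c * u).
  have -> : c * p - c * u * a = c * (p - u * a) by ring.
  exact: idealMl.
Qed.

Lemma ideal_adjoin_sub I a p : is_ideal I -> I p -> ideal_adjoin I a p.
Proof. by move=> hI hp; exists 0; rewrite mul0r subr0. Qed.

Lemma ideal_adjoin_gen I a : is_ideal I -> ideal_adjoin I a a.
Proof. by move=> hI; exists 1; rewrite mul1r subrr; apply: ideal0. Qed.

(** The colon ideal (I : a). Lemmas about an arbitrary ideal are applied to it when only multiples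
    by [a] are known to lie in I. *)
Definition colon I (a p : cox k) : Prop := I (a * p).

Lemma colon_ideal I a : is_ideal I -> is_ideal (colon I a).
Proof.
move=> hI; split; rewrite /colon.
- by rewrite mulr0; apply: ideal0.
- by move=> p q hp hq; rewrite mulrDr; apply: idealD.
- by move=> c p hp; rewrite mulrCA; apply: idealMl.
Qed.

(** Congruences respect sums, products and powers, so replacing each variable by something congruent
    to it changes p only modulo I. *)
Lemma ideal_subst I (h : 'I_4 -> cox k) p : is_ideal I ->
  (forall i, I ('X_i - h i)) -> I (p - mmap (@mpolyC 4 k) h p).
Proof.
move=> hI hh; rewrite {1}[p]mpolyE /mmap -sumrB; apply: ideal_sum => // m _.
rewrite -mul_mpolyC -mulrBr; apply: idealMl => //.
rewrite mpolyXE_id /mmap1; elim/big_ind2: _ => [|x1 x2 y1 y2|i _].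
- by rewrite subrr; apply: ideal0.
- exact: ideal_congrM.
- exact: ideal_congrX.
Qed.

(** The powers of p lying in the ideals I + (l) multiply to a power of p lying in I plus the ideal
    of the product; a further power puts that product into I. *)
Lemma radical_prod_ideal I (s : seq (cox k)) p : is_ideal I ->
  radical I (\prod_(l <- s) l) ->
  (forall l, l \in s -> exists n, ideal_adjoin I l (p ^+ n)) ->
  exists n, I (p ^+ n).
Proof.
move=> hI [r hr] hs.
have [n [u hn]] : exists n, ideal_adjoin I (\prod_(l <- s) l) (p ^+ n).
  elim: s hs {hr} => [|l s IH] hs.
    by exists 0%N, 1; rewrite big_nil expr0 mulr1 subrr; apply: ideal0.
  have [|n [u hn]] := IH; first by move=> l' l's; apply: hs; rewrite inE l's orbT.
  have [|n' [u' hn']] := hs l; first by rewrite mem_head.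
  exists (n' + n)%N, (u' * u); rewrite big_cons exprD.
  by rewrite mulrACA; apply: ideal_congrM.
exists (n * r)%N; rewrite exprM.
apply: (ideal_transl hI (ideal_congrX r hI hn)).
by rewrite exprMn; apply: idealMl.
Qed.

Lemma bihomog_idealP I : bihomog_ideal I -> is_ideal I. Proof. by case. Qed.

End Ideals.

(** * Bihomogeneous components *)

Section Grading.

Variable k : fieldType.
Implicit Types (p q : cox k) (I : cox k -> Prop) (d e : int * int).

Lemma mcoeff_bicomp d p m :
  (bicomp d p)@_m = if mbideg m == d then p@_m else 0.
Proof.
rewrite /bicomp (raddf_sum (mcoeff m)) /=.
under eq_bigr do rewrite mcoeffZ mcoeffX.
have [mp|mp] := boolP (m \in msupp p); last first.
  rewrite (memN_msupp_eq0 mp) if_same big1_seq // => n /andP[_ np].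
  by case: eqP => [nm|]; rewrite ?mulr0 //; rewrite nm (negbTE mp) in np.
rewrite big_mkcond (bigD1_seq m) ?msupp_uniq //= eqxx mulr1 big1 ?addr0 //.
by move=> n /negbTE ->; rewrite mulr0 if_same.
Qed.

Lemma bicompD d p q : bicomp d (p + q) = bicomp d p + bicomp d q.
Proof.
apply/mpolyP => m; rewrite mcoeffD !mcoeff_bicomp mcoeffD.
by case: ifP; rewrite ?addr0.
Qed.

Lemma bicomp_bihomog d p : bihomog d (bicomp d p).
Proof.
move=> m; rewrite mcoeff_msupp mcoeff_bicomp.
by case: (mbideg m =P d) => //; rewrite eqxx.
Qed.

Lemma bihomog_mcoeff d p m : bihomog d p -> mbideg m != d -> p@_m = 0.
Proof.
move=> hp; apply: contraNeq; rewrite -mcoeff_msupp => mp.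
by apply/eqP; apply: hp.
Qed.

Lemma bicomp_id d p : bihomog d p -> bicomp d p = p.
Proof.
move=> hp; apply/mpolyP => m; rewrite mcoeff_bicomp.
by case: ifPn => // /(bihomog_mcoeff hp) ->.
Qed.

Lemma bicomp_neq d e p : bihomog d p -> d != e -> bicomp e p = 0.
Proof.
move=> hp de; apply/mpolyP => m; rewrite mcoeff_bicomp mcoeff0.
by case: eqP => // mE; apply: (bihomog_mcoeff hp); rewrite mE eq_sym.
Qed.

Lemma bihomog0 d : bihomog d (0 : cox k).
Proof. by move=> m; rewrite msupp0. Qed.

Lemma bihomogD d p q : bihomog d p -> bihomog d q -> bihomog d (p + q).
Proof. by move=> hp hq; rewrite -(bicomp_id hp) -(bicomp_id hq) -bicompD; apply: bicomp_bihomog. Qed.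

Lemma bihomogN d p : bihomog d p -> bihomog d (- p).
Proof. by move=> hp m; rewrite (perm_mem (msuppN p)); apply: hp. Qed.

Lemma bihomogM d e p q : bihomog d p -> bihomog e q -> bihomog (d + e) (p * q).
Proof.
move=> hp hq m /msuppM_le /allpairsP[[m1 m2] /= [h1 h2 ->]].
by rewrite mbidegD (hp _ h1) (hq _ h2).
Qed.

Lemma bihomog1 : bihomog 0 (1 : cox k).
Proof. by move=> m; rewrite msupp1 inE => /eqP ->; rewrite mbidegE /sdeg !mnm0E. Qed.

Lemma bihomogZ d c p : bihomog d p -> bihomog d (c *: p).
Proof. by move=> hp m /msuppZ_le; apply: hp. Qed.

Lemma bihomogX d p n : bihomog d p -> bihomog (d *+ n) (p ^+ n).
Proof.
move=> hp; elim: n => [|n IH]; first exact: bihomog1.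
by rewrite exprS mulrS; apply: bihomogM.
Qed.

Lemma bihomog_sum d (T : eqType) (s : seq T) (F : T -> cox k) :
  (forall t, t \in s -> bihomog d (F t)) -> bihomog d (\sum_(t <- s) F t).
Proof.
move=> hF; rewrite big_seq; elim/big_ind: _ => //; first exact: bihomog0.
by move=> p q; apply: bihomogD.
Qed.

Lemma bihomog_prod d (T : eqType) (s : seq T) (F : T -> cox k) :
  (forall t, t \in s -> bihomog d (F t)) ->
  bihomog (d *+ size s) (\prod_(t <- s) F t).
Proof.
elim: s => [|t s IH] hF; first by rewrite big_nil; apply: bihomog1.
rewrite big_cons /= mulrS; apply: bihomogM; first by apply: hF; rewrite mem_head.
by apply: IH => u us; apply: hF; rewrite inE us orbT.
Qed.

Definition side_deg (a : bool) : int * int := if a then (0, 1) else (1, 0).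

Lemma bihomog_var a b : bihomog (side_deg a) (var k a b).
Proof.
move=> m; rewrite msuppX inE => /eqP ->; rewrite mbidegE /sdeg !mnm1E.
by case: a; case: b.
Qed.

(** Once the component of bidegree d - e is removed from q, the rest times p has no monomial of
    bidegree d. *)
Lemma bicompM d e p q : bihomog e p -> bicomp d (p * q) = p * bicomp (d - e) q.
Proof.
move=> hp; have hR : bihomog (e + (d - e)) (p * bicomp (d - e) q).
  by apply: bihomogM => //; apply: bicomp_bihomog.
have -> : p * q = p * bicomp (d - e) q + p * (q - bicomp (d - e) q) by ring.
rewrite bicompD bicomp_id; last by rewrite addrC subrK in hR.
rewrite [X in _ + X](_ : _ = 0) ?addr0 //.
apply/mpolyP => m; rewrite mcoeff_bicomp mcoeff0; case: eqP => // hm.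
apply/eqP; rewrite mcoeff_eq0; apply/negP.
move=> /msuppM_le /allpairsP[[m1 m2] /= [h1 h2 hmm]].
move: h2; rewrite mcoeff_msupp mcoeffB mcoeff_bicomp.
rewrite -hm hmm mbidegD (hp _ h1) [e + _]addrC addrK eqxx subrr.
by rewrite eqxx.
Qed.

Definition bidegs p := undup [seq mbideg m | m <- msupp p].

Lemma bicomp_sum p : p = \sum_(d <- bidegs p) bicomp d p.
Proof.
apply/mpolyP => m; rewrite (raddf_sum (mcoeff m)) /=.
under eq_bigr do rewrite mcoeff_bicomp.
have [mp|mp] := boolP (m \in msupp p); last first.
  by rewrite (memN_msupp_eq0 mp) big1 // => d _; rewrite if_same.
rewrite (bigD1_seq (mbideg m)) ?undup_uniq //=; last first.
  by rewrite mem_undup map_f.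
by rewrite eqxx big1 ?addr0 // => d /negbTE; rewrite eq_sym => ->.
Qed.

Lemma bidegsP p d : d \in bidegs p -> exists i j : nat, d = (Posz i, Posz j).
Proof.
rewrite mem_undup => /mapP[m _ ->].
by exists (sdeg false m), (sdeg true m).
Qed.

Lemma bicomp_out p d : d \notin bidegs p -> bicomp d p = 0.
Proof.
rewrite mem_undup => hd; apply/mpolyP => m; rewrite mcoeff_bicomp mcoeff0.
case: eqP => // mE; apply/eqP; rewrite mcoeff_eq0; apply: contra hd => mp.
by rewrite -mE map_f.
Qed.

Lemma ideal2_bihomog d e (f g : cox k) :
  bihomog d f -> bihomog e g -> bihomog_ideal (ideal2 f g).
Proof.
move=> hf hg; split=> [|c p [u [v ->]]]; first exact: ideal2_ideal.
rewrite bicompD ![_ * f]mulrC ![_ * g]mulrC (bicompM _ _ hf) (bicompM _ _ hg).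
by exists (bicomp (c - d) u), (bicomp (c - e) v); rewrite mulrC [g * _]mulrC.
Qed.

(** For an ideal Q this is the largest bihomogeneous ideal contained in Q. *)
Definition hcore (Q : cox k -> Prop) p : Prop := forall d, Q (bicomp d p).

(* The coaction of the grading torus, which turns bidegrees into exponents. *)
Definition coaction : cox k -> {poly {poly cox k}} :=
  mmap (polyC \o polyC \o @mpolyC 4 k)
    (asg (fun a b => (var k a b)%:P%:P * (if a then 'X else 'X%:P))).

HB.instance Definition _ := GRing.RMorphism.on coaction.

Lemma regroup_monom (A : comNzRingType) (a b c d u w : A) m0 m1 m2 m3 :
  (a * u) ^+ m0 * (b * u) ^+ m1 * ((c * w) ^+ m2 * (d * w) ^+ m3) =
  a ^+ m0 * b ^+ m1 * (c ^+ m2 * d ^+ m3) * (u ^+ (m0 + m1) * w ^+ (m2 + m3)).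
Proof. rewrite !exprMn !exprD; ring. Qed.

Lemma coef_torus_monom (A : comNzRingType) (a b c d e : A) m0 m1 m2 m3 i j :
  (e%:P%:P * ((a%:P%:P * 'X%:P) ^+ m0 * (b%:P%:P * 'X%:P) ^+ m1 *
    ((c%:P%:P * 'X) ^+ m2 * (d%:P%:P * 'X) ^+ m3)) : {poly {poly A}})`_j`_i =
  if (m0 + m1 == i)%N && (m2 + m3 == j)%N
  then e * (a ^+ m0 * b ^+ m1 * (c ^+ m2 * d ^+ m3)) else 0.
Proof.
rewrite regroup_monom.
have -> : a%:P%:P ^+ m0 * b%:P%:P ^+ m1 * (c%:P%:P ^+ m2 * d%:P%:P ^+ m3) =
          (a ^+ m0 * b ^+ m1 * (c ^+ m2 * d ^+ m3))%:P%:P :> {poly {poly A}}.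
  by rewrite !(polyCM, polyC_exp).
rewrite -polyC_exp !mulrA -!polyCM coefCM coefXn eq_sym.
case: eqP => _; last by rewrite mulr0 coef0 andbF.
rewrite mulr1 andbT coefCM coefXn eq_sym.
by case: eqP; rewrite ?mulr1 ?mulr0 ?mulrA.
Qed.

Lemma coef_coaction p (i j : nat) :
  (coaction p)`_j`_i = bicomp (Posz i, Posz j) p.
Proof.
rewrite /coaction /mmap /bicomp coef_sum coef_sum [RHS]big_mkcond /=.
apply: eq_bigr => m _; rewrite mmap1_asg coef_torus_monom.
by rewrite -mul_mpolyC mpolyXE_id prod_var_idx.
Qed.

End Grading.

Arguments bicomp_bihomog {k} d p.
Arguments bihomog_var {k} a b.
Arguments bihomog0 {k} d.
Arguments bihomog1 {k}.
Arguments bihomogX {k d p} n _.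

(** * Prime ideals as predicates, and Gauss's lemma *)

Lemma least_nat (P : nat -> Prop) :
  (exists n, P n) -> exists n, P n /\ forall m, (m < n)%N -> ~ P m.
Proof.
move=> [n0 hn0]; apply: NNPP => hno.
suff h n : forall m, (m < n)%N -> ~ P m by apply: (h n0.+1 n0).
elim: n => // n IH m; rewrite ltnS leq_eqVlt => /orP[/eqP -> hn|]; last exact: IH.
by apply: hno; exists n.
Qed.

Definition prime_pred (R : comNzRingType) (Q : R -> Prop) : Prop :=
  [/\ Q 0, forall a b, Q a -> Q b -> Q (a + b), forall a b, Q b -> Q (a * b),
      forall a b, Q (a * b) -> Q a \/ Q b & ~ Q 1].

Lemma prime_pred_sum (R : comNzRingType) (Q : R -> Prop) (T : Type)
    (s : seq T) (P : pred T) (F : T -> R) : prime_pred Q ->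
  (forall t, P t -> Q (F t)) -> Q (\sum_(t <- s | P t) F t).
Proof. by case=> h0 hD _ _ _ hF; elim/big_ind: _. Qed.

(* Gauss's lemma: look at the first coefficients of the two factors outside Q. *)
Lemma prime_pred_poly (R : comNzRingType) (Q : R -> Prop) :
  prime_pred Q -> prime_pred (fun p : {poly R} => forall i, Q p`_i).
Proof.
move=> hQ; have [h0 hD hM hP h1] := hQ; split.
- by move=> i; rewrite coef0.
- by move=> p q hp hq i; rewrite coefD; apply: hD.
- by move=> p q hq i; rewrite coefM; apply: prime_pred_sum => // j _; apply: hM.
- move=> p q hpq; apply: NNPP => /not_or_and[hp hq].
  have [m [hm mP]] := least_nat (not_all_ex_not _ _ hp).
  have [n [hn nP]] := least_nat (not_all_ex_not _ _ hq).
  have lem (P : Prop) : ~ ~ P -> P := @NNPP P.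
  have := hpq (m + n)%N; rewrite coefM.
  have hmn : (m < (m + n).+1)%N by rewrite ltnS leq_addr.
  rewrite (bigD1 (Ordinal hmn)) //= addKn => hsum.
  have hrest : Q (\sum_(i < (m + n).+1 | i != Ordinal hmn) p`_i * q`_(m + n - i)).
    apply: prime_pred_sum => // i; rewrite -val_eqE /= => him.
    have [im|mi] := ltnP i m.
      by rewrite mulrC; apply: hM; apply: lem; apply: mP.
    apply: hM; apply: lem; apply: nP.
    have {him} mi : (m < i)%N by rewrite ltn_neqAle eq_sym him.
    by rewrite -(ltn_add2l i) subnKC ?ltn_add2r // -ltnS.
  have : Q (p`_m * q`_n).
    have -> : p`_m * q`_n = (p`_m * q`_n +
      \sum_(i < (m + n).+1 | i != Ordinal hmn) p`_i * q`_(m + n - i)) +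
      (-1) * \sum_(i < (m + n).+1 | i != Ordinal hmn) p`_i * q`_(m + n - i) by ring.
    by apply: hD => //; apply: hM.
  by case/hP.
- by move=> h; apply: h1; have := h 0%N; rewrite coef1.
Qed.

(** * From prime ideals to points of the product *)

Section Points.

Variable k : fieldType.
Implicit Types (p q : cox k) (Q : cox k -> Prop).

Lemma hcoreP Q p : Q 0 ->
  hcore Q p <-> forall j i : nat, Q (coaction p)`_j`_i.
Proof.
move=> Q0; split=> [h j i|h d]; first by rewrite coef_coaction.
have [/bidegsP[i [j ->]]|] := boolP (d \in bidegs p); first by rewrite -coef_coaction.
by move/bicomp_out ->.
Qed.

Lemma hcore_bicomp Q d p : Q 0 -> hcore Q p -> hcore Q (bicomp d p).
Proof.
move=> Q0 hp e; have [<-|de] := eqVneq d e.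
  by rewrite (bicomp_id (bicomp_bihomog _ _)); apply: hp.
by rewrite (bicomp_neq (bicomp_bihomog _ _) de).
Qed.

Lemma hcore_form Q d p : Q 0 -> bihomog d p -> hcore Q p <-> Q p.
Proof.
move=> Q0 hp; split=> [/(_ d)|Qp e]; first by rewrite bicomp_id.
have [<-|de] := eqVneq d e; first by rewrite bicomp_id.
by rewrite (bicomp_neq hp de).
Qed.

(** Through [coaction], [hcore Q] is the preimage of the extension of Q to polynomials in two
    indeterminates, which is prime by Gauss's lemma applied twice. *)
Lemma hcore_prime Q : prime_pred Q -> prime_pred (hcore Q).
Proof.
move=> hQ; have [h0 _ _ _ _] := hQ.
have := prime_pred_poly (prime_pred_poly hQ).
have E p : hcore Q p <-> _ := hcoreP p h0.
set G := (fun w : {poly {poly cox k}} => forall j i : nat, Q w`_j`_i) => hG.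
have {}E p : hcore Q p <-> G (coaction p) by apply: E.
have [g0 gD gM gP g1] := hG; clearbody G.
split.
- by apply/E; rewrite rmorph0.
- move=> p q /E hp /E hq; apply/E; rewrite rmorphD.
  by have := gD _ _ hp hq.
- by move=> p q /E hq; apply/E; rewrite rmorphM; apply: gM.
- by move=> p q /E; rewrite rmorphM => /gP[] h; [left|right]; apply/E.
- by move=> /E; rewrite rmorph1 => /g1.
Qed.

Lemma irrelevant_var i j : irrelevant (var k false i * var k true j).
Proof.
split; first by apply: idealMr; [exact: ideal2_ideal|case: i; [exact: ideal2r|exact: ideal2l]].
by apply: idealMl; [exact: ideal2_ideal|case: j; [exact: ideal2r|exact: ideal2l]].
Qed.

Lemma hcore_point Q i j : prime_pred Q ->
  ~ Q (var k false i * var k true j) -> is_point (hcore Q).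
Proof.
move=> hQ hij; have [h0 hD hM hP h1] := hcore_prime hQ; have [Q0 _ _ _ _] := hQ.
split=> //; first by split=> // d p; apply: hcore_bicomp.
move=> hB; have := hB _ (irrelevant_var i j).
move/(hcore_form Q0 (bihomogM (bihomog_var _ _) (bihomog_var _ _))).
exact: hij.
Qed.

Lemma hcore_sub (I : cox k -> Prop) Q :
  bihomog_ideal I -> (forall p, I p -> Q p) -> forall p, I p -> hcore Q p.
Proof. by move=> [_ hI] hIQ p hp d; apply/hIQ/hI. Qed.

End Points.

(** * Elimination in an affine chart *)

Section Chart.

Variable k : closedFieldType.
Variables (a j : bool).
Implicit Types (p q : cox k) (u w : {poly {poly k}}).

(* Dehomogenization at the variables (a, false) and (~~ a, j); the other
   variable of side a becomes the inner indeterminate. *)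
Definition chart_val (a' b : bool) : {poly {poly k}} :=
  if a' == a then (if b then 'X%:P else 1) else (if b == j then 1 else 'X).

Definition chart : cox k -> {poly {poly k}} :=
  mmap (polyC \o polyC) (asg chart_val).

HB.instance Definition _ := GRing.RMorphism.on chart.

Lemma chart_var a' b : chart (var k a' b) = chart_val a' b.
Proof. by rewrite /chart /var mmapX mmap1U asg_var_idx. Qed.

Lemma chartD p q : chart (p + q) = chart p + chart q. Proof. exact: rmorphD. Qed.
Lemma chartB p q : chart (p - q) = chart p - chart q. Proof. exact: rmorphB. Qed.
Lemma chartM p q : chart (p * q) = chart p * chart q. Proof. exact: rmorphM. Qed.

Lemma chartZ c p : chart (c *: p) = c%:P%:P * chart p.
Proof. exact: mmapZ. Qed.

Lemma chart_surj w : exists p, chart p = w.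
Proof.
elim/poly_ind: w => [|w c [p <-]]; first by exists 0; rewrite rmorph0.
have [r <-] : exists r, chart r = c%:P.
  elim/poly_ind: c => [|c d [r hr]]; first by exists 0; rewrite rmorph0.
  exists (r * var k a true + d%:MP); rewrite chartD chartM chart_var.
  by rewrite /chart_val eqxx hr polyCD polyCM; congr (_ + _); apply: mmapC.
exists (p * var k (~~ a) (~~ j) + r); rewrite chartD chartM chart_var.
rewrite /chart_val (_ : (~~ a == a) = false); last by case: (a).
by rewrite (_ : (~~ j == j) = false) //; case: (j).
Qed.

Lemma chart_common_divisor (I : cox k -> Prop) : is_ideal I ->
  (forall p c, I p -> chart p = c%:P -> c = 0) ->
  exists2 g : {poly {poly k}}, (1 < size g)%N & forall p, I p -> g %| chart p.
Proof.
move=> hI hno.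
have [h|h] := classic (forall p, I p -> chart p = 0).
  (* When every image is zero, any polynomial of positive degree serves. *)
  by exists 'X; [rewrite size_polyX|move=> p /h ->; apply: dvdp0].
have [p0 hp0] := not_all_ex_not _ _ h; have [Ip0 p00] := imply_to_and _ _ hp0.
have [|n [[p1 Ip1 [p1n0 <-]] hmin]] := @least_nat
  (fun n => exists2 p, I p & chart p <> 0 /\ size (chart p) = n).
  by exists (size (chart p0)), p0.
exists (chart p1).
  rewrite ltnNge; apply/negP => /size1_polyC p1C; apply: p1n0.
  by rewrite p1C (hno _ _ Ip1 p1C).
move=> p Ip; apply/eqP; apply: NNPP => hr.
set g := chart p1 in p1n0 hmin hr *; set u := chart p in hr *.
have := Pdiv.Idomain.divp_eq u g; set l := lead_coef g ^+ _ => hdiv.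
(* Since [chart] is onto, the multiplier [l] and the quotient lift to the Cox ring, so the
   pseudo-remainder is the image of an element of I, against minimality. *)
have [x hx] := chart_surj l%:P; have [y hy] := chart_surj (u %/ g).
apply: (hmin (size (u %% g))); first by rewrite ltn_modp; apply/eqP.
have hI' : I (x * p - y * p1) by apply: idealB => //; apply: idealMl.
exists (x * p - y * p1) => //.
suff -> : chart (x * p - y * p1) = u %% g by [].
by rewrite chartB !chartM hx hy mul_polyC hdiv addrC addKr.
Qed.

(** A divisor of least size above 1 works. Over a domain R, [%|] is pseudo-divisibility, that is,
    divisibility over the fraction field, so nonzero constants of R do not count as factors. *)
Lemma irreducible_divisor (R : idomainType) (g : {poly R}) : (1 < size g)%N ->
  exists2 q : {poly R}, irreducible_poly q & q %| g.
Proof.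
move=> hg; have [|n [[q [qg q1] <-] hmin]] := @least_nat
  (fun n => exists2 q : {poly R}, (q %| g) /\ (1 < size q)%N & size q = n).
  by exists (size g), g; rewrite ?dvdpp.
exists q => //; split=> // r r1 rq.
have q0 : q != 0 by rewrite -size_poly_gt0; apply: ltn_trans q1.
have rsz : (size r <= size q)%N by apply: dvdp_leq.
rewrite -dvdp_size_eqp // eqn_leq rsz leqNgt; apply/negP => hlt.
apply: (hmin _ hlt); exists r => //; split; first exact: dvdp_trans qg.
rewrite ltn_neqAle eq_sym r1 size_poly_gt0; apply: contraNneq q0 => r0.
by rewrite r0 dvd0p in rq.
Qed.

(** As [%|] is divisibility over the fraction field, Euclid's argument applies: q is coprime to u
    and divides w, or its gcd with u is associate to q. *)
Lemma irreducible_prime_pred (R : idomainType) (q : {poly R}) :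
  irreducible_poly q -> prime_pred (fun u : {poly R} => q %| u).
Proof.
move=> [q1 hq]; split; rewrite ?dvdp0 //.
- by move=> u w; apply: dvdp_add.
- by move=> u w; apply: dvdp_mull.
- move=> u w huw; have [hc|hc] := boolP (coprimep q u).
    by right; rewrite -(Gauss_dvdpr _ hc).
  left; rewrite coprimep_def in hc.
  have := hq _ hc (dvdp_gcdl q u) => /eqp_dvdl <-; exact: dvdp_gcdr.
- by rewrite dvdp1 => /eqP qs; rewrite qs in q1.
Qed.

Lemma prime_pred_preim (R S : comNzRingType) (f : {rmorphism R -> S}) (Q : S -> Prop) :
  prime_pred Q -> prime_pred (fun x => Q (f x)).
Proof.
case=> h0 hD hM hP h1; split.
- by rewrite rmorph0.
- by move=> x y hx hy; rewrite rmorphD; apply: hD.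
- by move=> x y hy; rewrite rmorphM; apply: hM.
- by move=> x y; rewrite rmorphM; apply: hP.
- by rewrite rmorph1.
Qed.

Lemma chart_point (Q : {poly {poly k}} -> Prop) :
  prime_pred Q -> is_point (hcore (fun p => Q (chart p))).
Proof.
move=> hQ; have [_ _ _ _ h1] := hQ.
have hQ' := prime_pred_preim [the {rmorphism _ -> _} of chart] hQ.
(* These are the two dehomogenizing variables; their product has image 1, which is outside Q. *)
apply: (@hcore_point k _ (if a then j else false) (if a then false else j)) => //.
rewrite chartM !chart_var /chart_val.
by case: (a) => /=; rewrite eqxx mulr1.
Qed.

Lemma chart_elimination (X : closed_subscheme k) : has_dim X 0 ->
  exists p c, [/\ scheme_ideal X p, c != 0 & chart p = c%:P].
Proof.
move=> [_ hX]; apply: NNPP => hno; apply: hX.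
have hIb := scheme_bihomog X; have hI := bihomog_idealP hIb.
have [p c Ip pc|g g1 hg] := chart_common_divisor hI.
  by apply/eqP; apply: NNPP => /negP c0; apply: hno; exists p, c.
have [q hq qg] := irreducible_divisor g1.
have hQ := irreducible_prime_pred hq; have [q1 _] := hq.
(* The leading coefficient survives at [a0], so specialization keeps the positive degree of q and
   leaves a root [b0]. *)
have [a0 ha0] : exists a0, ~~ root (lead_coef q) a0.
  by apply/closed_nonrootP; rewrite lead_coef_eq0 irredp_neq0.
have szq : size (map_poly (horner_eval a0) q) = size q.
  by apply: size_map_poly_id0.
have [b0 hb0] : exists b0, root (map_poly (horner_eval a0) q) b0.
  by apply/closed_rootP; rewrite szq; case: (size q) q1 => [|[]].
pose Q1 w := w.[b0%:P].[a0] = 0.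
have hQ1 : prime_pred Q1.
  rewrite /Q1; split.
  - by rewrite !horner0.
  - by move=> u w hu hw; rewrite !hornerD hu hw addr0.
  - by move=> u w hw; rewrite !hornerM hw mulr0.
  - by move=> u w; rewrite !hornerM => /eqP; rewrite mulf_eq0 => /orP[]/eqP; tauto.
  - by rewrite !hornerC => /eqP; rewrite oner_eq0.
have qQ1 : Q1 q.
  by move/rootP: hb0; rewrite -{1}(hornerC b0 a0) -/(horner_eval a0 _) horner_map.
(* Pseudo-divisibility only makes a power of the leading coefficient times u a multiple of q; that
   power is nonzero at [a0], so u vanishes at (a0, b0). *)
have QQ1 u : q %| u -> Q1 u.
  move/eqP => hu; have := Pdiv.Idomain.divp_eq u q; rewrite hu addr0 /Q1.
  move/(congr1 (fun w => w.[b0%:P].[a0])); rewrite hornerZ !hornerM qQ1 mulr0.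
  rewrite horner_exp => /eqP; rewrite mulf_eq0 expf_eq0 -/(root _ _) (negbTE ha0).
  by rewrite andbF => /eqP.
pose P (i : nat) := if i is 0 then hcore (fun p => is_true (q %| chart p))
                    else hcore (fun p => Q1 (chart p)).
have hIq p : scheme_ideal X p -> q %| chart p.
  by move/hg; apply: dvdp_trans.
exists P; split=> [i _|i].
  split; first by case: i => [|i]; [apply: chart_point hQ|apply: chart_point hQ1].
  case: i => [|i]; first exact: hcore_sub.
  by apply: hcore_sub => // p /hIq/QQ1.
case: i => // _; split; first by move=> p hp d; apply/QQ1/hp.
(* This form makes the inclusion strict: it vanishes at the closed point, while its image is a
   nonzero constant in the outer indeterminate, not divisible by q. *)
pose l := var k a true - a0 *: var k a false.
have lh : bihomog (side_deg a) l.
  by apply: bihomogD; [|apply/bihomogN/bihomogZ]; apply: bihomog_var.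
have cl : chart l = ('X - a0%:P)%:P.
  rewrite chartB chartZ !chart_var /chart_val eqxx mulr1.
  by rewrite polyCB.
exists l; split.
  apply/(hcore_form _ lh); rewrite ?rmorph0 /Q1 ?horner0 // cl.
  by rewrite hornerC !hornerE subrr.
move/(hcore_form _ lh); rewrite rmorph0 dvdp0 cl => /(_ isT) hd.
have := dvdp_leq _ hd; rewrite polyC_eq0 polyXsubC_eq0 => /(_ isT).
by rewrite size_polyC polyXsubC_eq0 leqNgt q1.
Qed.

End Chart.

(** * Saturation by the irrelevant ideal *)

Section Saturation.

Variable k : fieldType.
Implicit Types (p q : cox k) (I K : cox k -> Prop).

Definition gen_irr (ij : bool * bool) : cox k := var k false ij.1 * var k true ij.2.

(** The saturation (I : B^oo), tested only on powers of the four generators x_i y_j of B;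
    [irrelevant_exp_saturation] passes to powers of B itself. *)
Definition saturation I p : Prop := forall ij, exists n, I (gen_irr ij ^+ n * p).

Lemma gen_irr_bihomog ij : bihomog (1, 1) (gen_irr ij).
Proof. exact: bihomogM (bihomog_var _ _) (bihomog_var _ _). Qed.

Lemma exponent_uniform (P : bool * bool -> nat -> Prop) :
  (forall ij m n, (m <= n)%N -> P ij m -> P ij n) ->
  (forall ij, exists n, P ij n) -> exists n, forall ij, P ij n.
Proof.
move=> up h.
have [n1 h1] := h (false, false); have [n2 h2] := h (false, true).
have [n3 h3] := h (true, false); have [n4 h4] := h (true, true).
exists (maxn (maxn n1 n2) (maxn n3 n4)) => -[[] []].
- by apply: up h4; rewrite !leq_max leqnn !orbT.
- by apply: up h3; rewrite !leq_max leqnn !orbT.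
- by apply: up h2; rewrite !leq_max leqnn !orbT.
- by apply: up h1; rewrite !leq_max leqnn.
Qed.

Lemma saturation_uniform I p : is_ideal I -> saturation I p ->
  exists n, forall ij, I (gen_irr ij ^+ n * p).
Proof.
move=> hI; apply: exponent_uniform => ij m n /subnK <- h.
by rewrite exprD -mulrA; apply: idealMl.
Qed.

(** With a common exponent n for the four generators, the n-th power of a generator times p is a
    power of the generator times p^n. *)
Lemma saturation_exp I p : is_ideal I ->
  (forall ij, exists n, I ((gen_irr ij * p) ^+ n)) -> exists n, saturation I (p ^+ n).
Proof.
move=> hI /exponent_uniform[|n hn].
  by move=> ij m n; apply: idealX_le.
by exists n => ij; exists n; rewrite -exprMn.
Qed.

Lemma saturation_ideal I : is_ideal I -> is_ideal (saturation I).
Proof.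
move=> hI; split.
- by move=> ij; exists 0%N; rewrite mulr0; apply: ideal0.
- move=> p q hp hq ij; have [m hm] := hp ij; have [n hn] := hq ij.
  exists (m + n)%N; rewrite mulrDr; apply: idealD => //.
    by rewrite exprD mulrAC mulrC; apply: idealMl.
  by rewrite exprD -mulrA; apply: idealMl.
- move=> c p hp ij; have [m hm] := hp ij.
  by exists m; rewrite mulrCA; apply: idealMl.
Qed.

Lemma saturation_sub I p : is_ideal I -> I p -> saturation I p.
Proof. by move=> hI hp ij; exists 0%N; rewrite mul1r. Qed.

Lemma saturation_saturated I p : saturation (saturation I) p -> saturation I p.
Proof.
move=> h ij; have [m hm] := h ij; have [n hn] := hm ij.
by exists (n + m)%N; rewrite exprD -mulrA.
Qed.

Lemma saturation_bihomog I : bihomog_ideal I -> bihomog_ideal (saturation I).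
Proof.
move=> [hI hb]; split; first exact: saturation_ideal.
move=> d p hp ij; have [n hn] := hp ij; exists n.
have hg : bihomog ((1, 1) *+ n) (gen_irr ij ^+ n).
  by apply/bihomogX/gen_irr_bihomog.
have := hb (d + (1, 1) *+ n) _ hn; rewrite (bicompM _ _ hg).
by rewrite addrK.
Qed.

(** Reduction modulo the two variables of side [a]: its kernel is the ideal they generate. *)
Definition kill (a : bool) : cox k -> cox k :=
  mmap (@mpolyC 4 k) (asg (fun a' b => if a' == a then 0 else var k a' b)).

HB.instance Definition _ a := GRing.RMorphism.on (kill a).

Lemma kill_var a b : kill a (var k a b) = 0.
Proof. by rewrite /kill /var mmapX mmap1U asg_var_idx eqxx. Qed.

Lemma kill_congr a p : ideal2 (var k a false) (var k a true) (p - kill a p).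
Proof.
have h2 := ideal2_ideal (var k a false) (var k a true).
apply: ideal_subst => // i.
have [a' [b ->]] := var_idxP i; rewrite asg_var_idx; case: eqP => [->|_].
  by rewrite subr0; case: b; [apply: ideal2r|apply: ideal2l].
by rewrite subrr; apply: ideal0.
Qed.

Lemma kill_ideal2 a p : ideal2 (var k a false) (var k a true) p -> kill a p = 0.
Proof.
move=> [u [v ->]].
have -> : kill a (u * var k a false + v * var k a true) =
  kill a u * kill a (var k a false) + kill a v * kill a (var k a true).
  by rewrite rmorphD !rmorphM.
by rewrite !kill_var !mulr0 addr0.
Qed.

(** The products x_i y_j generate B: write b = u x_0 + v x_1 and subtract its image under
    [kill true], which is zero. The coefficients of x_0 and x_1 become u and v minus their images,
    and these lie in the ideal of y_0, y_1. *)
Lemma irrelevant_gen K b : is_ideal K -> (forall ij, K (gen_irr ij)) ->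
  irrelevant b -> K b.
Proof.
move=> hK hg [[u [v hb]] hy]; have hb0 := kill_ideal2 (a := true) hy.
have hx i w : K (var k false i * (w - kill true w)).
  apply: (ideal2_sub (colon_ideal (var k false i) hK) _ _ (kill_congr true w)).
    exact: (hg (i, false)).
  exact: (hg (i, true)).
have kx i : kill true (var k false i) = var k false i.
  by rewrite /kill /var mmapX mmap1U asg_var_idx.
have -> : b = var k false false * (u - kill true u) +
              var k false true * (v - kill true v).
  rewrite -[LHS]subr0 -hb0 hb -[x0]/(var k false false) -[x1]/(var k false true).
  have -> : kill true (u * var k false false + v * var k false true) =
    kill true u * kill true (var k false false) +
    kill true v * kill true (var k false true) by rewrite rmorphD !rmorphM.
  rewrite !kx; ring.
by apply: idealD.
Qed.

(* Pigeonhole on the exponents of the four generators of B. *)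
Lemma irrelevant_exp_sub l : forall (e : bool * bool -> nat) K, is_ideal K ->
  (forall ij, K (gen_irr ij ^+ e ij)) -> (\sum_ij e ij <= l)%N ->
  forall b, ideal_exp irrelevant l b -> K b.
Proof.
elim: l => [|l IH] e K hK hg he b.
  move=> _; have := hg (false, false).
  rewrite (_ : e _ = 0%N); first by rewrite -[b]mulr1; apply: idealMl.
  by apply/eqP; move: he; rewrite leqn0 sum_nat_eq0 => /forallP/(_ (false, false)).
move=> [s [hs ->]]; apply: ideal_sum => // -[b1 c] /hs /= [hb1 hc].
rewrite mulrC; apply: (irrelevant_gen (colon_ideal c hK)) hb1 => ij.
rewrite /colon mulrC.
have [e0|e0] := posnP (e ij).
  by have := hg ij; rewrite e0 -[_ * _]mulr1; apply: idealMl.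
(* Passing to the colon ideal by this generator lowers its exponent, hence the sum of exponents, by
   one. *)
pose e' ij' := if ij' == ij then (e ij).-1 else e ij'.
apply: (IH e' _ (colon_ideal (gen_irr ij) hK)) hc.
  move=> ij'; rewrite /colon /e'; case: eqP => [->|_]; last exact: idealMl.
  by rewrite -exprS prednK.
rewrite -ltnS; apply: leq_trans he.
rewrite (bigD1 ij) //= [X in (_ < X)%N](bigD1 ij) //= /e' eqxx.
rewrite (eq_bigr e) => [|ij' /negbTE -> //].
by rewrite ltn_add2r prednK.
Qed.

Lemma irrelevant_exp_saturation I p : is_ideal I -> saturation I p ->
  exists l, forall b, ideal_exp irrelevant l b -> I (b * p).
Proof.
move=> hI /(saturation_uniform hI)[n hn].
exists (\sum_(ij : bool * bool) n)%N => b hb; rewrite mulrC.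
apply: (irrelevant_exp_sub (colon_ideal p hI) _ _ hb); last exact: leqnn.
by move=> ij; rewrite /colon mulrC.
Qed.

Lemma B_saturatedP I p : is_ideal I -> B_saturated I -> saturation I p -> I p.
Proof. by move=> hI hB /(irrelevant_exp_saturation hI)[l]; apply: hB. Qed.

Lemma irrelevant_exp n (b : cox k) : irrelevant b -> ideal_exp irrelevant n (b ^+ n).
Proof.
move=> hb; elim: n => // n IH; rewrite exprS.
exists [:: (b, b ^+ n)]; split; last by rewrite big_seq1.
by move=> ab; rewrite inE => /eqP ->.
Qed.

Lemma kill_form a d (h : cox k) : bihomog d h ->
  (0 < if a then d.2 else d.1)%R -> kill a h = 0.
Proof.
move=> hh hd; rewrite /kill /mmap big1_seq // => m /andP[_ /hh hm].
have m0 : (0 < sdeg a m)%N by move: hd; rewrite -hm mbidegE; case: (a).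
have zero i j : (0 < i + j)%N -> 0 ^+ i * 0 ^+ j = 0 :> cox k.
  by case: i => [|i]; [case: j => // j _|move=> _]; rewrite !expr0n ?mul0r ?mulr0.
by rewrite mmap1_asg; case: (a) m0 => /= m0; rewrite zero ?mul0r ?mulr0.
Qed.

Lemma form_irrelevant d (h : cox k) : bihomog d h -> (0 < d.1)%R -> (0 < d.2)%R -> irrelevant h.
Proof.
move=> hh h1 h2; split.
  by have := kill_congr false h; rewrite (kill_form hh) // subr0.
by have := kill_congr true h; rewrite (kill_form hh) // subr0.
Qed.

End Saturation.

(** * Homogenization from a chart *)

Section Homogenization.

Variable k : closedFieldType.
Implicit Types (p q F : cox k) (I : cox k -> Prop) (a j : bool).

Lemma mmap1_chart a j m :
  mmap1 (asg (@chart_val k a j)) m =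
    ('X^(m (var_idx a true)))%:P * 'X^(m (var_idx (~~ a) (~~ j))).
Proof.
by rewrite mmap1_asg polyC_exp; case: a; case: j; rewrite /chart_val /= !expr1n;
  rewrite ?mul1r ?mulr1 // mulrC.
Qed.

(** The exponents of the two variables set to 1 are recovered from the bidegree. *)
Lemma mnm_chart_inj a j (m n : 'X_{1..4}) : mbideg m = mbideg n ->
  m (var_idx a true) = n (var_idx a true) ->
  m (var_idx (~~ a) (~~ j)) = n (var_idx (~~ a) (~~ j)) -> m = n.
Proof.
rewrite !mbidegE => -[h1 h2]; have h b : sdeg b m = sdeg b n by case: b.
move=> ha hj; apply/mnmP => i; have [a' [b ->]] := var_idxP i.
have [->|] := eqVneq a' a.
  case: b => //; have := h a; rewrite /sdeg ha; exact: addIn.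
case: a a' ha hj {h1 h2} => -[] //= ha hj _; [have := h false|have := h true];
  rewrite /sdeg; case: j hj => /= hj; rewrite hj; case: b => //;
  first [exact: addnI|exact: addIn].
Qed.

Lemma side_degMn a n :
  side_deg a *+ n = if a then (0, Posz n) else (Posz n, 0).
Proof.
elim: n => [|n IH]; first by case: a.
by rewrite mulrS IH; case: a {IH}; rewrite -[(_, _) + (_, _)]/(_ + _, _ + _) addr0.
Qed.

(** Distinct monomials of one bidegree have distinct images, so the coefficients of p can be read
    off in the chart. *)
Lemma chart_form_inj a j d p : bihomog d p -> chart a j p = 0 -> p = 0.
Proof.
move=> hp h0; apply/mpolyP => m; rewrite mcoeff0.
have [mp|/memN_msupp_eq0 //] := boolP (m \in msupp p).
move/(congr1 (fun w : {poly {poly k}} =>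
  w`_(m (var_idx (~~ a) (~~ j)))`_(m (var_idx a true)))): h0.
rewrite !coef0 /chart /mmap !coef_sum => <-.
rewrite (bigD1_seq m) ?msupp_uniq //= mmap1_chart mulrA -polyCM coefCM coefXn eqxx mulr1.
rewrite coefCM coefXn eqxx mulr1 big1_seq ?addr0 // => n /andP[nm np].
rewrite mmap1_chart mulrA -polyCM coefCM coefXn.
have [h1|_] := eqVneq; last by rewrite mulr0 coef0.
rewrite mulr1 coefCM coefXn; have [h2|_] := eqVneq; last by rewrite mulr0.
by case/eqP: nm; apply: (@mnm_chart_inj a j) => //; rewrite (hp _ mp) (hp _ np).
Qed.

(* Padding every component of p by powers of the two variables inverted in the
   chart makes p a form without changing its image. *)
Lemma chart_homogenize a j I p F (r s : nat) : bihomog_ideal I -> I p ->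
  bihomog (Posz r, Posz s) F -> chart a j p = chart a j F ->
  exists m n, I (var k a false ^+ m * var k (~~ a) j ^+ n * F).
Proof.
move=> [hI hb] Ip hF hpF.
(* D bounds both degrees of F and of every component of p, so the subtractions in [u] never
   truncate. *)
pose D := (r + s + \sum_(e <- bidegs p) (absz e.1 + absz e.2))%N.
pose side (b : bool) (e : int * int) := absz (if b then e.2 else e.1).
pose u e := var k a false ^+ (D - side a e) * var k (~~ a) j ^+ (D - side (~~ a) e).
have cu e : chart a j (u e) = 1.
  rewrite /u chartM /chart !rmorphXn /= -/(chart a j) !chart_var /chart_val !eqxx.
  by rewrite (_ : (~~ a == a) = false) ?expr1n ?mulr1 //; case: (a).
have uh (i l : nat) : (i <= D)%N -> (l <= D)%N ->
  bihomog ((Posz D, Posz D) - (Posz i, Posz l)) (u (Posz i, Posz l)).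
  move=> iD lD; have := bihomogM (bihomogX (D - side a (Posz i, Posz l)) (bihomog_var a false))
    (bihomogX (D - side (~~ a) (Posz i, Posz l)) (bihomog_var (~~ a) j)).
  suff -> : (Posz D, Posz D) - (Posz i, Posz l) =
      side_deg a *+ (D - side a (Posz i, Posz l)) +
      side_deg (~~ a) *+ (D - side (~~ a) (Posz i, Posz l)) by [].
  rewrite !side_degMn -[(_, _) - (_, _)]/(_ - _, _ - _) !subzn // /side.
  case: (a) => /=; rewrite -[(_, _) + (_, _)]/(_ + _, _ + _);
    by rewrite ?addr0 ?add0r.
have uhD e q : e \in (Posz r, Posz s) :: bidegs p -> bihomog e q ->
    bihomog (Posz D, Posz D) (u e * q).
  rewrite inE => he hq; suff [i [l [e_eq iD lD]]] : exists i l : nat,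
      [/\ e = (Posz i, Posz l), (i <= D)%N & (l <= D)%N].
    by rewrite e_eq in hq *; rewrite -[(Posz D, _)](subrK (Posz i, Posz l));
      apply: bihomogM => //; apply: uh.
  case/orP: he => [/eqP ->|he]; first by
    exists r, s; split=> //; rewrite /D -addnA ?leq_addr // addnCA leq_addr.
  have [i [l e_eq]] := bidegsP he; exists i, l; rewrite e_eq; split=> //.
    rewrite /D (bigD1_seq e) ?undup_uniq //= e_eq /=.
    by apply: leq_trans (leq_addl _ _); rewrite -addnA leq_addr.
  rewrite /D (bigD1_seq e) ?undup_uniq //= e_eq /=.
  by apply: leq_trans (leq_addl _ _); rewrite addnAC leq_addl.
pose p' := \sum_(e <- bidegs p) u e * bicomp e p.
have p'I : I p' by apply: ideal_sum => // e _; apply: idealMl => //; apply: hb.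
have p'h : bihomog (Posz D, Posz D) p'.
  apply: bihomog_sum => e he; apply: uhD; last exact: bicomp_bihomog.
  by rewrite inE he orbT.
have Fh : bihomog (Posz D, Posz D) (u (Posz r, Posz s) * F).
  by apply: uhD => //; rewrite mem_head.
have cp' : chart a j p' = chart a j p.
  rewrite [in RHS](bicomp_sum p) /p' /chart !raddf_sum; apply: eq_bigr => e _.
  by rewrite -/(chart a j) /= -/(chart a j _) chartM cu mul1r.
(* Both sides are forms of bidegree (D, D) with the same image in the chart. *)
have p'F : p' = u (Posz r, Posz s) * F.
  apply/eqP; rewrite -subr_eq0; apply/eqP.
  apply: (@chart_form_inj a j (Posz D, Posz D)).
    by apply: bihomogD => //; apply: bihomogN.
  by rewrite chartB chartM cu cp' mul1r hpF subrr.
by exists (D - side a (Posz r, Posz s))%N, (D - side (~~ a) (Posz r, Posz s))%N;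
  rewrite -/(u _) -p'F.
Qed.
End Homogenization.

(** * Linear forms and closed points *)

Section LinearForms.

Variable k : fieldType.
Implicit Types (p q : cox k) (I K : cox k -> Prop) (a b : bool) (c : option k).

(* A point of P^1: Some t stands for (1 : t) and None for (0 : 1). *)
Definition coord c b : k :=
  match c with
  | Some t => if b then t else 1
  | None => if b then 1 else 0
  end.

(** The linear form on side [a] whose only zero is [c], up to a scalar. *)
Definition lin a c : cox k :=
  if c is Some t then var k a true - t *: var k a false else var k a false.

Definition lin_at (c1 c : option k) : k :=
  if c1 is Some t then coord c true - t * coord c false else coord c false.

Definition unit_coord c : bool := ~~ isSome c.

Lemma coord_unit c : coord c (unit_coord c) = 1. Proof. by case: c. Qed.

Lemma lin_at_eq0 c1 c : (lin_at c1 c == 0) = (c1 == c).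
Proof.
case: c1 c => [t|] [u|] /=; rewrite ?mulr1 ?mulr0 ?subr0 ?oner_eq0 ?eqxx //.
by rewrite subr_eq0 eq_sym.
Qed.

Lemma bihomog_lin a c : bihomog (side_deg a) (lin a c).
Proof.
case: c => [t|]; last exact: bihomog_var.
by apply: bihomogD; [|apply/bihomogN/bihomogZ]; apply: bihomog_var.
Qed.

(** Linear forms with distinct zeros span both variables; for two finite points, their difference is
    a nonzero multiple of the first variable. *)
Lemma lin_span K a c c1 i : is_ideal K -> c1 != c ->
  K (lin a c) -> K (lin a c1) -> K (var k a i).
Proof.
move=> hK hc h h1; suff h0 : K (var k a false).
  case: i => //; case: c c1 h h1 hc => [t|] [u|] //= h h1 _;
  by [rewrite -(subrK (t *: var k a false) (var k a true));
      apply: idealD => //; apply: idealZ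
     |rewrite -(subrK (u *: var k a false) (var k a true));
      apply: idealD => //; apply: idealZ].
case: c c1 h h1 hc => [t|] [u|] //= h h1 hc.
have hut : u - t != 0 by rewrite subr_eq0; apply: contra hc => /eqP ->.
have -> : var k a false = (u - t)^-1 *: ((var k a true - t *: var k a false) -
                                    (var k a true - u *: var k a false)).
  rewrite -!mul_mpolyC.
  have -> : (var k a true - t%:MP * var k a false) - (var k a true - u%:MP * var k a false) =
            (u%:MP - t%:MP) * var k a false by ring.
  by rewrite -mpolyCB mulrA -mpolyCM mulVf // mul1r.
by apply: idealZ => //; apply: idealB.
Qed.

(* Substitution of a point of P^1, scaled by one coordinate, on each side a where
   [o a] is given. *)
Definition restrict (o : bool -> option (option k)) : cox k -> cox k :=
  mmap (@mpolyC 4 k) (asg (fun a b =>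
    if o a is Some c then coord c b *: var k a (unit_coord c) else var k a b)).

HB.instance Definition _ o := GRing.RMorphism.on (restrict o).

Lemma restrict_var o a b : restrict o (var k a b) =
  if o a is Some c then coord c b *: var k a (unit_coord c) else var k a b.
Proof. by rewrite /restrict /var mmapX mmap1U asg_var_idx. Qed.

Lemma restrictZ o t p : restrict o (t *: p) = t *: restrict o p.
Proof. by rewrite /restrict mmapZ mul_mpolyC. Qed.

Lemma restrict_lin o a c1 : restrict o (lin a c1) =
  if o a is Some c then lin_at c1 c *: var k a (unit_coord c) else lin a c1.
Proof.
case: c1 => [t|] /=; last by rewrite restrict_var.
rewrite rmorphB /= restrictZ !restrict_var; case: (o a) => // c.
by rewrite scalerBl scalerA.
Qed.

Lemma restrict_congr o K p : is_ideal K ->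
  (forall a c, o a = Some c -> K (lin a c)) -> K (p - restrict o p).
Proof.
move=> hK ho; apply: ideal_subst => // i.
have [a [b ->]] := var_idxP i; rewrite asg_var_idx -/(var k a b).
have := ho a; case: (o a) => [c|_]; last by rewrite subrr; apply: ideal0.
move/(_ c erefl); case: c => [t|]; case: b => //= h.
- by rewrite scale1r subrr; apply: ideal0.
- by rewrite scale1r subrr; apply: ideal0.
- by rewrite scale0r subr0.
Qed.

Definition pt c c' : 'I_4 -> k := asg (fun a => coord (if a then c' else c)).

Lemma meval_lin a c1 c c' :
  (lin a c1).@[pt c c'] = lin_at c1 (if a then c' else c).
Proof.
case: c1 => [t|] /=; last by rewrite mevalXU /pt asg_var_idx.
by rewrite mevalB mevalZ !mevalXU /pt !asg_var_idx.
Qed.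

Lemma lin_neq0 a c : lin a c != 0.
Proof.
pose c1 : option k := if c is None then Some 0 else None.
have : lin_at c c1 != 0 by rewrite lin_at_eq0 /c1; case: (c).
apply: contraNneq => l0; have := meval_lin a c c1 c1.
by rewrite l0 meval0 if_same => <-.
Qed.

(** Every monomial of a form contributes its value at the point times one and the same monomial in
    the variables normalized to 1. *)
Lemma form_restrict c c' i j p : bihomog (Posz i, Posz j) p ->
  restrict (fun a => Some (if a then c' else c)) p =
  p.@[pt c c'] *: (var k false (unit_coord c) ^+ i * var k true (unit_coord c') ^+ j).
Proof.
move=> hp; rewrite /restrict /meval /mmap scaler_suml.
apply: eq_big_seq => m /hp; rewrite mbidegE => -[<- <-].
rewrite /pt !mmap1_asg /= -!mul_mpolyC regroup_monom /sdeg mulrA.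
by rewrite !mpolyCM !rmorphXn /= !mulrA.
Qed.

Lemma form_congr K c c' i j p : is_ideal K ->
  K (lin false c) -> K (lin true c') -> bihomog (Posz i, Posz j) p ->
  K (p - p.@[pt c c'] *: (var k false (unit_coord c) ^+ i * var k true (unit_coord c') ^+ j)).
Proof.
move=> hK h h' hp; rewrite -form_restrict //; apply: restrict_congr => // a c1 [<-].
by case: a.
Qed.

(** The bihomogeneous prime of the point (c, c'); vanishing at the single representative [pt c c']
    is not a bihomogeneous condition, whence [hcore]. *)
Definition closed_pt c c' : cox k -> Prop := hcore (fun p => p.@[pt c c'] = 0).

Lemma closed_pt_prime c c' : prime_pred (closed_pt c c').
Proof.
apply: hcore_prime; split.
- exact: meval0.
- by move=> p q hp hq; rewrite mevalD hp hq addr0.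
- by move=> p q hq; rewrite mevalM hq mulr0.
- by move=> p q; rewrite mevalM => /eqP; rewrite mulf_eq0 => /orP[]/eqP; tauto.
- by rewrite meval1 => /eqP; rewrite oner_eq0.
Qed.

Lemma closed_pt_form c c' d p : bihomog d p -> closed_pt c c' p <-> p.@[pt c c'] = 0.
Proof. by move=> hp; apply: hcore_form hp; apply: meval0. Qed.

Lemma closed_pt_sub K c c' p : is_ideal K ->
  K (lin false c) -> K (lin true c') -> closed_pt c c' p -> K p.
Proof.
move=> hK h h' hp; rewrite (bicomp_sum p); apply: ideal_sum => // d dp.
have [i [j dE]] := bidegsP dp; subst d.
have := form_congr hK h h' (bicomp_bihomog (Posz i, Posz j) p).
by rewrite hp scale0r subr0.
Qed.

Lemma gen_irr_pt c c' : (gen_irr k (unit_coord c, unit_coord c')).@[pt c c'] = 1.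
Proof. by rewrite mevalM !mevalXU /pt !asg_var_idx !coord_unit mulr1. Qed.

Lemma radical_points I (sx sy : seq (option k)) p : bihomog_ideal I ->
  (forall q, saturation I q -> I q) ->
  radical I (\prod_(c <- sx) lin false c) -> radical I (\prod_(c <- sy) lin true c) ->
  radical I p <->
  forall c c', (forall q, I q -> closed_pt c c' q) -> closed_pt c c' p.
Proof.
move=> hIb hsat hx hy; have hI := bihomog_idealP hIb.
split=> [[n hn] c c' hc|hp].
  have [_ _ _ hP h1] := closed_pt_prime c c'.
  move/hc: hn; elim: n => [/h1 //|n IH].
  by rewrite exprS => /hP[].
suff [n hn] : exists n, saturation I (p ^+ n) by exists n; apply: hsat.
apply: saturation_exp => // ij.
apply: (@radical_prod_ideal _ _ (map (lin false) sx)) => //; first by rewrite big_map.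
move=> _ /mapP[c _ ->]; have hIc := ideal_adjoin_ideal (lin false c) hI.
apply: (@radical_prod_ideal _ _ (map (lin true) sy)) => //.
  by rewrite big_map; have [n hn] := hy; exists n; apply: ideal_adjoin_sub.
move=> _ /mapP[c' _ ->]; set K := ideal_adjoin _ _.
have hK : is_ideal K by apply: ideal_adjoin_ideal.
have KI q : I q -> K q by move=> hq; do 2! apply: ideal_adjoin_sub => //.
have Kc : K (lin false c) by apply: ideal_adjoin_sub => //; apply: ideal_adjoin_gen.
have Kc' : K (lin true c') by apply: ideal_adjoin_gen.
(* If (c, c') lies on I, then p vanishes there and belongs to K already. *)
have [hV|hV] := classic (forall q, I q -> closed_pt c c' q).
  exists 1%N; rewrite expr1; apply: idealMl => //.
  exact: closed_pt_sub Kc Kc' (hp _ _ hV).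
have [q hq] := not_all_ex_not _ _ hV; have {hq hV} [Iq hq] := imply_to_and _ _ hq.
have [d hd] := not_all_ex_not _ _ hq.
have [/bidegsP[i [j dE]]|/bicomp_out q0] := boolP (d \in bidegs q); last first.
  by case: hd; rewrite q0 meval0.
subst d; set e := _.@[_] in hd; have [_ hb] := hIb.
set s := var k false (unit_coord c); set t := var k true (unit_coord c').
(* Off the zero locus of I some form of I has a nonzero value [e], so K contains this monomial. The
   generator of B is a multiple of s t modulo K, so its power i + j lies in K. *)
have Kst : K (s ^+ i * t ^+ j).
  have := form_congr hK Kc Kc' (bicomp_bihomog (Posz i, Posz j) q).
  move/(ideal_transr hK)/(_ (KI _ (hb _ _ Iq)))/(idealZ e^-1 hK).
  by rewrite scalerA mulVf ?scale1r //; apply/eqP.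
exists (i + j)%N; rewrite exprMn; apply: idealMr => //.
have := form_congr hK Kc Kc' (@gen_irr_bihomog k ij); rewrite !expr1.
move/(ideal_congrX (i + j) hK)/(ideal_transl hK); apply.
rewrite exprZn; apply: idealZ => //; rewrite exprMn exprD [t ^+ _]exprD.
rewrite mulrAC; apply: idealMr => //; rewrite mulrCA; apply: idealMl => //.
Qed.

End LinearForms.

(** * Products of linear forms in the ideal of X *)

Section SideProduct.

Variables (k : closedFieldType) (X : closed_subscheme k) (hX : has_dim X 0).

Lemma scheme_ideal_sat p : saturation (scheme_ideal X) p -> scheme_ideal X p.
Proof.
by apply: B_saturatedP; [case: (scheme_bihomog X)|exact: scheme_saturated].
Qed.

Lemma side_product_chart a j : exists (s : seq (option k)) n,
  scheme_ideal X (var k (~~ a) j ^+ n * \prod_(c <- s) lin a c).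
Proof.
have [p [c [Ip c0 pc]]] := chart_elimination a j hX.
have hIb := scheme_bihomog X; have hI := bihomog_idealP hIb.
have [r hr] := closed_field_poly_normal c; set l := lead_coef c in hr.
have l0 : l != 0 by rewrite lead_coef_eq0.
pose F := \prod_(t <- r) lin a (Some t).
have Fh : bihomog (side_deg a *+ size r) F.
  by apply: bihomog_prod => t _; apply: bihomog_lin.
have cF : chart a j (l^-1 *: p) = chart a j F.
  rewrite chartZ pc hr -polyCM -mul_polyC mulrA -polyCM mulVf // mul1r.
  rewrite /F /chart rmorph_prod rmorph_prod; apply: eq_bigr => t _ /=.
  rewrite -/(chart a j _) chartB chartZ !chart_var /chart_val eqxx mulr1.
  by rewrite polyCB.
have [m [n hmn]] : exists m n, scheme_ideal X (var k a false ^+ m * var k (~~ a) j ^+ n * F).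
  have [u [v uv]] : exists u v : nat, side_deg a *+ size r = (Posz u, Posz v).
    by rewrite side_degMn; case: ifP => _; do 2! eexists.
  rewrite uv in Fh; apply: (chart_homogenize hIb _ Fh cF).
  exact: idealZ.
(* The factor [var k a false ^+ m] is itself a product of linear forms, with zero at [None]. *)
exists (nseq m None ++ map Some r), n.
by rewrite big_cat big_nseq iter_mulr_1 big_map /= mulrA [_ * _ ^+ m]mulrC.
Qed.

(** The two charts leave a power of one or the other variable of the opposite side; each generator
    of B is divisible by one of these variables, so saturation removes the powers. *)
Lemma side_product a :
  exists s : seq (option k), scheme_ideal X (\prod_(c <- s) lin a c).
Proof.
have hI := bihomog_idealP (scheme_bihomog X).
have [s0 [n0 h0]] := side_product_chart a false.
have [s1 [n1 h1]] := side_product_chart a true.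
exists (s0 ++ s1); apply: scheme_ideal_sat => ij; rewrite big_cat /=.
set P0 := \prod_(c <- s0) _ in h0 *; set P1 := \prod_(c <- s1) _ in h1 *.
have [u uE] : exists u, gen_irr k ij = u * var k (~~ a) (if a then ij.1 else ij.2).
  rewrite /gen_irr; case: (a); last by eexists.
  by exists (var k true ij.2); rewrite mulrC.
rewrite uE; case: (if a then _ else _).
  exists n1; rewrite exprMn mulrACA -mulrA; apply: idealMl => //.
  exact: idealMl.
exists n0; rewrite exprMn -mulrA; apply: idealMl => //.
by rewrite mulrA; apply: idealMr.
Qed.

End SideProduct.

(** * Equations of a finite set of points *)

Section Equations.

Variable k : fieldType.
Variable V : seq (option k * option k).
Implicit Types (p q : cox k) (K : cox k -> Prop) (c : option k).

Definition columns := undup (map fst V).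

Definition fiber c := [seq z.2 | z <- V & z.1 == c].

(** Points of other columns are replaced by a repeated point of the fibre; for [c] in [columns] the
    fibre is nonempty and the default [None] is not reached. *)
Definition fiber_pt c (z : option k * option k) : option k :=
  if z.1 == c then z.2 else head None (fiber c).

(* The product runs over all of V so that the degree does not depend on c. *)
Definition fiber_form c : cox k := \prod_(z <- V) lin true (fiber_pt c z).

Definition others_form c : cox k := \prod_(c1 <- rem c columns) lin false c1.

Definition eq_f : cox k := \prod_(c <- columns) lin false c.

Definition eq_g : cox k := \sum_(c <- columns) fiber_form c * others_form c.

Lemma mem_fiber c c' : (c' \in fiber c) = ((c, c') \in V).
Proof.
apply/mapP/idP => [[[z1 z2]]|h].
  by rewrite mem_filter => /andP[/eqP /= <- h] ->.
by exists (c, c'); rewrite ?mem_filter ?eqxx.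
Qed.

Lemma fiber_ptP c z : c \in columns -> z \in V -> (c, fiber_pt c z) \in V.
Proof.
rewrite mem_undup => /mapP[[z1 z2] zV ->] /=; rewrite /fiber_pt => hz.
case: eqP => [<-|_]; first by case: z hz.
rewrite -mem_fiber; have : z2 \in fiber z1 by rewrite mem_fiber.
by case: (fiber z1) => // t s _; rewrite mem_head.
Qed.

Lemma eq_f_bihomog : bihomog (Posz (size columns), 0) eq_f.
Proof.
rewrite -(@side_degMn false); apply: bihomog_prod => c _; exact: bihomog_lin.
Qed.

(** For empty V the predecessor truncates, but [eq_g] is then an empty sum, and 0 is a form of every
    bidegree. *)
Lemma eq_g_bihomog : bihomog (Posz (size columns).-1, Posz (size V)) eq_g.
Proof.
apply: bihomog_sum => c hc.
have -> : (Posz (size columns).-1, Posz (size V)) =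
    side_deg true *+ size V + side_deg false *+ size (rem c columns).
  rewrite !side_degMn size_rem // -[(_, _) + (_, _)]/(_ + _, _ + _).
  by rewrite add0r addr0.
by apply: bihomogM; apply: bihomog_prod => t _; apply: bihomog_lin.
Qed.

Lemma meval_prod_lin a (T : eqType) (s : seq T) (F : T -> option k) c c' :
  ((\prod_(t <- s) lin a (F t)).@[pt c c'] == 0) =
  has (fun t => F t == if a then c' else c) s.
Proof.
rewrite rmorph_prod; elim: s => [|t s IH]; first by rewrite big_nil oner_eq0.
by rewrite big_cons mulf_eq0 IH /= meval_lin lin_at_eq0.
Qed.

Lemma eq_f_zero c c' : (eq_f.@[pt c c'] == 0) = (c \in columns).
Proof. by rewrite /eq_f (meval_prod_lin _ _ id) has_pred1. Qed.

Lemma lin_dvd_others K c c1 : is_ideal K -> K (lin false c) -> c \in columns -> c1 != c ->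
  K (others_form c1).
Proof.
move=> hK hc cC c1c; rewrite /others_form (big_rem c) /=.
  by apply: idealMr.
by rewrite (rem_filter _ (undup_uniq _)) mem_filter /= cC eq_sym c1c.
Qed.

(** On the column c only its own summand survives, the others having [lin false c] as a factor. *)
Lemma eq_g_congr K c : is_ideal K -> K (lin false c) -> c \in columns ->
  K (eq_g - fiber_form c * others_form c).
Proof.
move=> hK hc cC; rewrite /eq_g (bigD1_seq c) ?undup_uniq //= addrAC subrr add0r.
rewrite -big_filter; apply: ideal_sum => // c1; rewrite mem_filter => /andP[c1c _].
by apply: idealMl => //; apply: lin_dvd_others c1c.
Qed.

(** [eq_g_congr] is applied to the ideal of polynomials vanishing at the point; [others_form c] is
    nonzero there, as [columns] has no repetition. *)
Lemma eq_g_zero c c' : c \in columns ->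
  (eq_g.@[pt c c'] == 0) = ((c, c') \in V).
Proof.
move=> cC; have : ((eq_g - fiber_form c * others_form c).@[pt c c'] = 0).
  have hp := closed_pt_prime c c'; case: hp => h0 hD hM _ _.
  apply: (eq_g_congr (K := fun p => p.@[pt c c'] = 0)) => //.
    split; first exact: meval0.
      by move=> p q; rewrite mevalD => -> ->; rewrite addr0.
    by move=> p q; rewrite mevalM => ->; rewrite mulr0.
  by apply/eqP; rewrite meval_lin lin_at_eq0.
rewrite mevalB => /eqP; rewrite subr_eq0 => /eqP ->.
rewrite mevalM mulf_eq0 /others_form (meval_prod_lin _ _ id) has_pred1.
rewrite mem_rem_uniq ?undup_uniq // inE eqxx orbF.
rewrite /fiber_form meval_prod_lin; apply/hasP/idP => [[z zV /eqP <-]|hV].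
  exact: fiber_ptP.
by exists (c, c'); rewrite // /fiber_pt eqxx.
Qed.

Definition eq_ideal : cox k -> Prop := saturation (ideal2 eq_f eq_g).

Lemma eq_ideal_bihomog : bihomog_ideal eq_ideal.
Proof.
apply: saturation_bihomog; exact: ideal2_bihomog eq_f_bihomog eq_g_bihomog.
Qed.

Lemma eq_ideal_points c c' :
  (forall q, eq_ideal q -> closed_pt c c' q) <-> (c, c') \in V.
Proof.
have hI := ideal2_ideal eq_f eq_g.
split=> [h|hV q hq].
  have /(closed_pt_form _ _ eq_f_bihomog)/eqP := h _ (saturation_sub hI (ideal2l _ _)).
  rewrite eq_f_zero => cC; rewrite -eq_g_zero //; apply/eqP.
  by apply/(closed_pt_form _ _ eq_g_bihomog)/h/saturation_sub => //; apply: ideal2r.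
have cC : c \in columns by rewrite mem_undup; apply/mapP; exists (c, c').
have [h0 hD hM hP h1] := closed_pt_prime c c'.
have hc : is_ideal (closed_pt c c') by split.
(* This generator of B has value 1 at the point, so its powers cancel in the prime ideal of the
   point. *)
have [n hn] := hq (unit_coord c, unit_coord c').
have {hn} : closed_pt c c' (gen_irr k (unit_coord c, unit_coord c') ^+ n * q).
  apply: (ideal2_sub hc _ _ hn).
    by apply/(closed_pt_form _ _ eq_f_bihomog)/eqP; rewrite eq_f_zero.
  by apply/(closed_pt_form _ _ eq_g_bihomog)/eqP; rewrite eq_g_zero.
elim: n => [|n IH]; first by rewrite mul1r.
rewrite exprS -mulrA => /hP[|//].
move/(closed_pt_form _ _ (@gen_irr_bihomog k _)); rewrite gen_irr_pt => /eqP.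
by rewrite oner_eq0.
Qed.

(** Each factor, having a zero other than c, spans the variables together with [lin false c]; it is
    traded for x_i inside a colon ideal. *)
Lemma ideal_prod_lin K c (s : seq (option k)) i q : is_ideal K -> K (lin false c) ->
  c \notin s -> K ((\prod_(c1 <- s) lin false c1) * q) -> K (var k false i ^+ size s * q).
Proof.
move=> hK hc; elim: s q => [|c1 s IH] q; first by rewrite big_nil.
rewrite inE negb_or => /andP[cc1 cs]; rewrite big_cons -mulrA mulrCA => /IH - /(_ cs) h.
rewrite /= exprS -mulrA mulrC.
apply: (@lin_span _ _ false c c1 i (colon_ideal _ hK)); rewrite /colon.
- by rewrite eq_sym.
- exact: idealMl.
- by rewrite -mulrA [q * _]mulrC.
Qed.

(** Modulo [lin false c], g is [fiber_form c] times linear forms in x that can be traded for a power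
    of x_i. Hence a power of x_i y_j times the product lies in the ideal of f, g and [lin false c],
    for every column. *)
Lemma eq_ideal_fibers :
  radical eq_ideal (\prod_(c' <- [seq fiber_pt c z | c <- columns, z <- V]) lin true c').
Proof.
have hI := ideal2_ideal eq_f eq_g.
apply: saturation_exp => // ij; set H := \prod_(c' <- _) _.
apply: (@radical_prod_ideal _ _ (map (lin false) columns)) => //.
  by exists 1%N; rewrite big_map expr1; apply: ideal2l.
move=> _ /mapP[c cC ->]; set K := ideal_adjoin _ _.
have hK : is_ideal K by apply: ideal_adjoin_ideal.
have Kc : K (lin false c) by apply: ideal_adjoin_gen.
have Kg : K eq_g by apply: ideal_adjoin_sub => //; apply: ideal2r.
have [w ->] : exists w, H = w * fiber_form c.
  rewrite /H big_allpairs_dep (bigD1_seq c) ?undup_uniq //= mulrC.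
  by eexists.
have := ideal_transr hK (eq_g_congr hK Kc cC) Kg.
rewrite mulrC => /(@ideal_prod_lin _ _ _ ij.1 _ hK Kc).
rewrite mem_rem_uniq ?undup_uniq // inE eqxx => /(_ isT).
set x := var k false _; set n := size _ => h; exists n.+1.
have -> : (gen_irr k ij * (w * fiber_form c)) ^+ n.+1 =
  x * var k true ij.2 ^+ n.+1 * w ^+ n.+1 * fiber_form c ^+ n * (x ^+ n * fiber_form c).
  rewrite /gen_irr -/x !exprMn !exprS; ring.
exact: idealMl.
Qed.

Lemma eq_f_radical : radical eq_ideal (\prod_(c <- columns) lin false c).
Proof. by exists 1%N; apply: saturation_sub; [apply: ideal2_ideal|apply: ideal2l]. Qed.

End Equations.

(** * The Koszul complex of f and g *)

Section KoszulResolution.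

Variable k : fieldType.
Variable V : seq (option k * option k).

Lemma var_neq0 a b : var k a b != 0.
Proof. by rewrite -msupp_eq0 msuppX. Qed.

(* Each linear factor of f generates a prime ideal not containing g. *)
Lemma eq_g_regular (s : seq (option k)) (v u : cox k) :
  {subset s <= columns V} -> eq_g V * v = (\prod_(c <- s) lin false c) * u ->
  exists w, v = (\prod_(c <- s) lin false c) * w.
Proof.
elim: s v => [|c s IH] v hs hv; first by exists v; rewrite big_nil mul1r.
have cC : c \in columns V by apply: hs; rewrite mem_head.
(* Reduction modulo [lin false c], realized as an endomorphism of the Cox ring; primality is used as
   the absence of zero divisors in the target. *)
pose psi := restrict (fun a => if a then None else Some c).
have psiM p q : psi (p * q) = psi p * psi q by exact: rmorphM.
have psiB p q : psi (p - q) = psi p - psi q by exact: rmorphB.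
have psi_c : psi (lin false c) = 0.
  have /eqP c0 : lin_at c c == 0 by rewrite lin_at_eq0.
  by rewrite /psi restrict_lin c0 scale0r.
have psi_g : psi (eq_g V) != 0.
  have hK : is_ideal (fun p => psi p = 0).
    split; first exact: rmorph0.
      by move=> p q hp hq; rewrite /psi rmorphD /= -/psi hp hq addr0.
    by move=> p q hq; rewrite psiM hq mulr0.
  have := eq_g_congr hK psi_c cC; rewrite psiB => /eqP; rewrite subr_eq0 => /eqP ->.
  rewrite psiM mulf_neq0 // /psi rmorph_prod prodf_seq_neq0; apply/allP => t ht /=.
    by rewrite restrict_lin lin_neq0.
  rewrite restrict_lin -mul_mpolyC mulf_neq0 ?var_neq0 // mpolyC_eq0 lin_at_eq0.
  by apply: contraTneq ht => ->; rewrite mem_rem_uniq ?undup_uniq // inE eqxx.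
have [v' v'E] : exists v', v = lin false c * v'.
  have psi_v : psi v = 0.
    move/(congr1 psi): hv; rewrite big_cons !psiM psi_c !mul0r => /eqP.
    by rewrite mulf_eq0 (negbTE psi_g) => /eqP.
  (* The second generator 0 makes this the principal ideal of [lin false c]. *)
  have : ideal2 (lin false c) 0 (v - psi v).
    apply: restrict_congr; first exact: ideal2_ideal.
    by case=> // _ [<-]; apply: ideal2l.
  by case=> v' [w]; rewrite psi_v subr0 mulr0 addr0 mulrC => ->; exists v'.
have [||w v'w] := IH v'; last by exists w; rewrite v'E v'w big_cons mulrA.
- by move=> t ts; apply: hs; rewrite inE ts orbT.
- apply: (mulfI (lin_neq0 false c)); move: hv; rewrite v'E big_cons => hv.
  by rewrite mulrCA hv mulrA.
Qed.

Lemma eq_f_neq0 : eq_f V != 0.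
Proof. by rewrite prodf_seq_neq0; apply/allP => c _; apply: lin_neq0. Qed.

Local Notation d := (Posz (size (columns V)), 0 : int).
Local Notation e := (Posz (size (columns V)).-1, Posz (size V)).
Local Notation F := (koszul d e (eq_f V) (eq_g V)).

Lemma koszul_graded : graded_complex F.
Proof.
have hf := @eq_f_bihomog k V; have hg := @eq_g_bihomog k V.
split=> -[|[|i]] //=.
- by move=> p q; rewrite mxE subr0; case: ifP.
- move=> p q; rewrite mxE; case: ifP => _; last by rewrite addrK.
  by rewrite [d + e]addrC addrK; apply: bihomogN.
- by move=> p q; rewrite mxE; apply: bihomog0.
- apply/matrixP => p q; rewrite !mxE big_ord_recl big_ord1 !mxE /=.
  by ring.
- by rewrite mulmx0.
- by rewrite mul0mx.
Qed.

(** The homology itself is zero. In degree 1, a relation f v_0 + g v_1 = 0 gives v_1 = f w by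
    regularity, then v_0 = - g w; in degree 2, multiplication by f is injective. *)
Lemma koszul_exact i b : annihilates_homology F i b.
Proof.
case: i => [|[|i]] v hv.
- have := congr1 (fun M : 'M_(1, 1) => M 0 0) hv.
  rewrite !mxE big_ord_recl big_ord1 !mxE /= => hv0.
  have [||w hw] := @eq_g_regular (columns V) (v (lift ord0 ord0) 0) (- v ord0 0) => //.
    rewrite -/(eq_f V); apply/eqP; rewrite -subr_eq0 mulrN opprK addrC.
    by apply/eqP.
  have hw0 : v ord0 0 = - eq_g V * w.
    apply: (mulfI eq_f_neq0); apply/eqP; rewrite -subr_eq0; apply/eqP.
    rewrite -[RHS]hv0 hw -/(eq_f V); ring.
  exists (\col_(j < 1) (b * w)).
  apply/matrixP => p q; rewrite ord1 !mxE big_ord1 !mxE.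
  case: p => -[|[|//]] hp /=.
    rewrite (_ : Ordinal hp = ord0); last exact: val_inj.
    rewrite hw0; ring.
  rewrite (_ : Ordinal hp = lift ord0 ord0); last exact: val_inj.
  rewrite hw -/(eq_f V); ring.
- exists 0; rewrite mulmx0.
  have := congr1 (fun M : 'M_(2, 1) => M (lift ord0 ord0) 0) hv.
  rewrite !mxE big_ord1 !mxE /= => /eqP; rewrite mulf_eq0 (negbTE eq_f_neq0) => /eqP v0.
  by apply/matrixP => p q; rewrite !ord1 !mxE v0 mulr0.
- by exists 0; apply/matrixP => -[].
Qed.

Lemma koszul_rel (v : 'cV[cox k]_1) :
  @Defs.rel k (coker_module F) v <-> ideal2 (eq_f V) (eq_g V) (v 0 0).
Proof.
split=> [[w ->]|[a [b ab]]] /=.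
  rewrite !mxE big_ord_recl big_ord1 !mxE /=.
  by exists (w ord0 0), (w (lift ord0 ord0) 0); ring.
exists (\col_(j < 2) (if j == 0 then a else b)).
apply/matrixP => p q; rewrite !ord1 ab !mxE big_ord_recl big_ord1 !mxE /=.
ring.
Qed.

(** A form h of positive bidegree lies in B, so a power of h carries the saturation into the ideal.
    The identity on representatives therefore induces the sheaf isomorphism. *)
Lemma koszul_section_eq dh h (s t : 'cV[cox k]_1 * nat) : basic_open dh h ->
  @section_eq k (quot_module (eq_ideal V)) h s t <->
  @section_eq k (coker_module F) h s t.
Proof.
have hI := ideal2_ideal (eq_f V) (eq_g V).
move=> [_ hh h1 h2]; split=> -[l].
  rewrite /= mxE => /(irrelevant_exp_saturation hI)[m hm].
  exists (m + l)%N; apply/koszul_rel; rewrite mxE exprD -mulrA.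
  exact/hm/irrelevant_exp/(form_irrelevant hh).
by move/koszul_rel => hl; exists l; apply: saturation_sub.
Qed.

Lemma koszul_section_refl h s : @section_eq k (coker_module F) h s s.
Proof.
exists 0%N; apply/koszul_rel; rewrite subrr scaler0 mxE.
by apply: ideal0; apply: ideal2_ideal.
Qed.

Lemma koszul_virtual_resolution : virtual_resolution (eq_ideal V) F.
Proof.
split; first exact: koszul_graded.
  by move=> i; exists 1%N => // b _; apply: koszul_exact.
exists (fun _ s => s); split=> [dh h hh|*]; last exact: koszul_section_refl.
split=> //.
- by move=> s t _ _; apply: koszul_section_eq hh.
- by move=> u hu; exists u => //; apply: koszul_section_refl.
- by move=> *; apply: koszul_section_refl.
- by move=> *; apply: koszul_section_refl.
Qed.

End KoszulResolution.

(** * The points of X and the conclusion *)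

Lemma classic_filter (T : eqType) (s : seq T) (P : T -> Prop) :
  exists t : seq T, forall x, x \in t <-> x \in s /\ P x.
Proof.
elim: s => [|y s [t ht]]; first by exists [::] => x; split=> [|[]].
have [Py|nPy] := classic (P y); [exists (y :: t)|exists t] => x; rewrite !inE.
  split=> [/orP[/eqP ->|/ht[xs Px]]|[/orP[->//|xs] Px]]; first by rewrite eqxx.
    by rewrite xs orbT.
  by apply/orP; right; apply/ht.
split=> [/ht[-> Px]|[/orP[/eqP xy|xs] Px]]; first by rewrite orbT.
  by rewrite xy in Px.
exact/ht.
Qed.

(** A closed point of X is a zero of both products of linear forms, so it lies on the finite grid of
    their zeros. *)
Lemma scheme_points (k : closedFieldType) (X : closed_subscheme k) :
  has_dim X 0 -> exists V : seq (option k * option k), forall c c',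
    (c, c') \in V <-> forall q, scheme_ideal X q -> closed_pt c c' q.
Proof.
move=> hX; have [sx hsx] := side_product hX false; have [sy hsy] := side_product hX true.
have [V hV] := classic_filter [seq (c, c') | c <- sx, c' <- sy]
  (fun z => forall q, scheme_ideal X q -> closed_pt z.1 z.2 q).
exists V => c c'; split=> [/hV[] //|h]; apply/hV; split=> //.
have hs a (s : seq (option k)) : scheme_ideal X (\prod_(c1 <- s) lin a c1) ->
    (if a then c' else c) \in s.
  move/h/(closed_pt_form _ _ (bihomog_prod _)) => hp.
  rewrite -has_pred1 -(meval_prod_lin a s id c c'); apply/eqP/hp.
  by move=> t _; apply: bihomog_lin.
by apply/allpairsP; exists (c, c'); rewrite (hs false) ?(hs true).
Qed.

Theorem theorem2p1 (k : closedFieldType) (X : closed_subscheme k)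
    (hX : has_dim X 0) :
  exists J : {mpoly k[4]} -> Prop,
    bihomog_ideal J /\
    (forall p, radical J p <-> radical (scheme_ideal X) p) /\
    exists (d e : int * int) (f g : {mpoly k[4]}),
      bihomog d f /\ bihomog e g /\ virtual_resolution J (koszul d e f g).
Proof.
have [sx hsx] := side_product hX false; have [sy hsy] := side_product hX true.
have [V hV] := scheme_points hX.
exists (eq_ideal V); split; first exact: eq_ideal_bihomog.
split=> [p|]; last first.
  do 2! eexists; exists (eq_f V), (eq_g V); split; first exact: eq_f_bihomog.
  by split; [exact: eq_g_bihomog|exact: koszul_virtual_resolution].
(* Both radicals are determined by closed points, and V is the set of closed points of either
   ideal. *)
rewrite (radical_points p (eq_ideal_bihomog V) _ (eq_f_radical V) (eq_ideal_fibers V)).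
  rewrite (@radical_points _ _ sx sy p (scheme_bihomog X)).
  - by split=> h c c' hc; apply: h; [apply/eq_ideal_points/hV|apply/hV/eq_ideal_points].
  - exact: scheme_ideal_sat.
  - by exists 1%N.
  - by exists 1%N.
exact: saturation_saturated.
Qed.
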